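(* For every integer $t>1$ there exists $n_0$ such that for all $n\ge n_0$, $$\mathrm{ex}_3(n,F_t^3)=\binom{n}{3}-\binom{n-t}{3}.$$
   Context: For an $r$-uniform hypergraph ($r$-graph) $\mathcal F$, $\mathrm{ex}_r(n,\mathcal F)$ denotes the maximum number of hyperedges in an $n$-vertex $r$-graph that does not contain $\mathcal F$ as a subhypergraph. The $t$-fan $F_t$ is the graph on $2t+1$ vertices consisting of $t$ triangles which pairwise intersect in exactly one common vertex (the center). For a graph $F$, its $r$-expansion $F^r$ is the $r$-graph obtained from $F$ by adding to each edge of $F$ a set of $r-2$ new vertices, where all $(r-2)|E(F)|$ new vertices are distinct from each other and from $V(F)$; each edge together with its new vertices becomes a hyperedge. Thus $F_t^3$ is a 3-graph with $5t+1$ vertices and $3t$ hyperedges. *)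

(* Defs.v *)
From mathcomp Require Import all_boot.
Set Implicit Arguments. Unset Strict Implicit. Unset Printing Implicit Defensive.

Definition uniform3 (n : nat) (H : {set {set 'I_n}}) : bool :=
  [forall e in H, #|e| == 3].

(* The t-fan F_t as a simple graph on vertex set option ('I_t * bool):
   None is the center, Some (i,false), Some (i,true) are the two other
   vertices of the i-th triangle. Edges are 2-element sets. *)
Definition fan (t : nat) : {set {set option ('I_t * bool)}} :=
  [set [set None; Some (ib.1, ib.2)] | ib : 'I_t * bool]
  :|: [set [set Some (i, false); Some (i, true)] | i : 'I_t].

(* The 3-expansion F^3 of a graph F = (V, E) is the 3-graph on V plus one
   new vertex per edge e (here: inr e), with hyperedges e ∪ {new vertex of e}.
   [contains_exp3 E H] : H contains F^3 as a (not necessarily induced)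
   subhypergraph, i.e. there is an injective map of the vertices of F^3 into
   'I_n sending each hyperedge of F^3 to a hyperedge of H. *)
Definition contains_exp3 (V : finType) (E : {set {set V}}) (n : nat)
    (H : {set {set 'I_n}}) : bool :=
  [exists f : {ffun (V + {e : {set V} | e \in E})%type -> 'I_n},
     injectiveb f &&
     [forall e : {e : {set V} | e \in E},
        (f (inr e) |: [set f (inl v) | v in val e]) \in H]].

Definition ex3_exp (V : finType) (E : {set {set V}}) (n : nat) : nat :=
  \max_(H : {set {set 'I_n}} | uniform3 H && ~~ contains_exp3 E H) #|H|.

(* Main.v *)
Require Import Defs.
From mathcomp Require Import all_boot.
From mathcomp Require Import zify.
Set Implicit Arguments. Unset Strict Implicit. Unset Printing Implicit Defensive.

(** Write [d(xy)] for the codegree of a pair, and call a pair heavy if [d(xy)] exceeds a large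
constant. In a 3-graph without the expanded fan, each vertex [c] has a set [X_c] of at most [5t]
vertices hitting every loose triangle based at [c].

Suppose there are about [t n^2 / 2] hyperedges. A discharging argument distributes them over
pairs: a hyperedge containing a pair of codegree at most [t] is charged to that pair; all but
[o(n^2)] of the others have two light pairs, and such hyperedges can be charged so that every pair
of codegree greater than [t] receives at most [t - 1/3]. Hence all but [o(n^2)] pairs have
codegree exactly [t], with heavy pairs towards their [t] apexes. The covers [X_c] then force
almost all pairs to share one and the same apex set [S], [|S| = t].

Finally let [weak s] be the set of vertices forming a light pair with [s]. A hyperedge avoiding
[S] has at least two vertices in every [weak s], so with [m = min |weak s|] there are at least
about [t m n] missing triples meeting [S]. On the other hand a vertex [u] of [weak s] has fewer
than [2t] partners of linear codegree in [weak s] (two such partners per triangle and one element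
of [S] for its outer edge would give a fan at [u]), so that only about [(t - 1/2) m n] hyperedges
avoid [S]. *)

(** * Loose triangles and fans *)

(** All counts run over ordered pairs and triples: hyperedges carry a factor 6, and the charge bound
    [t - 1/3] per pair appears as [3t - 1] against [3t]. That gap makes the discharging a stability
    statement: every pair of codegree other than [t] costs a fixed amount, so a deficit of [o(n^2)]
    leaves [o(n^2)] such pairs. The obstacle at the end is exactness. No error term may survive when
    the weak sets are empty, so each hyperedge avoiding [S] has to be paid for by weak vertices:
    both sides of the last comparison carry the factor [m], and the strict inequality between
    [t - 1/2] and [t] absorbs everything else. Good pairs serve there as ready-made outer edges,
    since the [t] elements of [S] expand [t] of them at once. A fan is always found by fixing one
    part of it and adding the rest greedily; the constants [5t], [5t + 4] and [2t + 2] count the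
    vertices that such a choice has to avoid. *)

Lemma perm_flatten_cat (T : eqType) (I : Type) (f g : I -> seq T) (s : seq I) :
  perm_eq (flatten [seq f i ++ g i | i <- s])
          (flatten [seq f i | i <- s] ++ flatten [seq g i | i <- s]).
Proof.
elim: s => //= i s IH; rewrite -!catA perm_cat2l perm_sym.
by rewrite perm_catCA perm_cat2l perm_sym.
Qed.

Lemma perm_flatten_map (T : eqType) (I : Type) (f g : I -> seq T) (s : seq I) :
  (forall i, perm_eq (f i) (g i)) ->
  perm_eq (flatten [seq f i | i <- s]) (flatten [seq g i | i <- s]).
Proof. by move=> fg; elim: s => //= i s IH; apply: perm_cat. Qed.

Lemma card_set_seq (V : finType) (s : seq V) : #|[set x in s]| <= size s.
Proof. by rewrite cardsE card_size. Qed.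

Lemma size_flatten_const (T I : Type) (f : I -> seq T) k (s : seq I) :
  (forall i, size (f i) = k) -> size (flatten [seq f i | i <- s]) = k * size s.
Proof. by move=> fk; elim: s => [|i s IH]; rewrite /= ?muln0 // size_cat fk IH mulnS. Qed.

Lemma flatten_map1 (T I : Type) (f : I -> T) (s : seq I) :
  flatten [seq [:: f i] | i <- s] = map f s.
Proof. by elim: s => //= i s ->. Qed.

(** A disjoint family that cannot be extended covers all other tuples by its own vertices. Used for
    loose triangles ([k = 5]), outer edges ([k = 2]) and open triangles ([k = 4]). *)
Lemma disjoint_or_cover (V T : finType) (vs : T -> seq V) (P : pred T) k t :
  (forall i, P i -> uniq (vs i)) -> (forall i, size (vs i) = k) ->
  (exists s : seq T, [/\ size s = t, all P s & uniq (flatten (map vs s))]) \/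
  (exists X : {set V}, #|X| <= k * t /\ forall i, P i -> has (mem X) (vs i)).
Proof.
move=> uvs kvs; elim: t => [|t [[s [sz Ps us]]|[X [cX hX]]]].
- by left; exists [::].
- case: (boolP [exists i, P i && ~~ has (mem (flatten (map vs s))) (vs i)]).
  + case/existsP=> i /andP[Pi ni]; left; exists (i :: s); split=> //=.
    * by rewrite sz.
    * by rewrite Pi.
    * rewrite cat_uniq uvs // us andbT /=; apply: contra ni => /hasP[x xs xi].
      by apply/hasP; exists x.
  + move=> nex; right; exists [set x in flatten (map vs s)]; split.
      apply: leq_trans (card_set_seq _) _.
      by rewrite (size_flatten_const _ kvs) sz leq_mul2l leqnSn orbT.
    move=> i Pi; move/existsPn/(_ i): nex; rewrite Pi /= negbK => /hasP[x xi xs].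
    by apply/hasP; exists x; rewrite //= inE.
- right; exists X; split=> //; apply: leq_trans cX _.
  by rewrite leq_mul2l leqnSn orbT.
Qed.

(** Representatives can be picked one after the other, since fewer than [size s] have been used
    before. The result stays paired with [s], so that expansion vertices remain attached to their
    edges. *)
Lemma greedy_sdr (V : finType) (T : Type) (A : T -> {set V}) (X : {set V}) (s : seq T) :
  all (fun i => size s <= #|A i :\: X|) s ->
  exists s' : seq (T * V), [/\ map fst s' = s, uniq (map snd s')
    & all (fun p => p.2 \in A p.1 :\: X) s'].
Proof.
have: size s <= size s by [].
(* The required size is frozen as [m] before the induction shortens [s]. *)
move: {2 3}(size s) => m; elim: s => [|i s IH] /=; first by exists [::].
move=> ltm /andP[Ai As]; have [s' [fs us all_s]] := IH (ltnW ltm) As.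
have szs : size (map snd s') = size s by rewrite -fs !size_map.
have: #|(A i :\: X) :\: [set x in map snd s']| > 0.
  have := cardsID [set x in map snd s'] (A i :\: X).
  have := subset_leq_card (subsetIr (A i :\: X) [set x in map snd s']).
  have := card_set_seq (map snd s'); rewrite szs.
  by move: #|_| #|_| #|_| #|_| Ai ltm; lia.
case/card_gt0P=> v; rewrite inE [_ \in [set _ in _]]inE => /andP[vs vA].
by exists ((i, v) :: s'); split; rewrite /= ?fs // ?vs // vA.
Qed.

(** The two transpositions generate all permutations of a triple, so [hneq] on the first two
    arguments gives distinctness of all three ([h_distinct]). *)
Record threegraph (V : finType) := ThreeGraph {
  hedge :> V -> V -> V -> bool;
  hC : forall x y z, hedge x y z = hedge y x z;
  hA : forall x y z, hedge x y z = hedge x z y;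
  hneq : forall x y z, hedge x y z -> x != y }.

Section Basics.
Variables (V : finType) (h : threegraph V).

Definition nbhd x y : {set V} := [set z | h x y z].
Definition codeg x y := #|nbhd x y|.

Lemma nbC x y : nbhd x y = nbhd y x.
Proof. by apply/setP=> z; rewrite !inE hC. Qed.

Lemma cdC x y : codeg x y = codeg y x.
Proof. by rewrite /codeg nbC. Qed.

Lemma in_nb x y z : (z \in nbhd x y) = h x y z.
Proof. by rewrite inE. Qed.

Lemma h_rot x y z : h x y z = h y z x.
Proof. by rewrite hC hA. Qed.

Lemma h_distinct x y z : h x y z -> [/\ x != y, x != z & y != z].
Proof.
move=> H; split; [exact: hneq H| |].
- by move: H; rewrite hA; apply: hneq.
- by move: H; rewrite h_rot; apply: hneq.
Qed.

(* [(a, b, x, y, z)] stands for the expansion of the triangle [c a b], with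
   hyperedges [c a x], [c b y], [a b z]. *)
Definition loose c (T : V * V * V * V * V) :=
  let: (a, b, x, y, z) := T in [&& h c a x, h c b y & h a b z].
Definition lverts (T : V * V * V * V * V) :=
  let: (a, b, x, y, z) := T in [:: a; b; x; y; z].

Variable t : nat.

Definition fan_free := forall c s, size s = t -> all (loose c) s ->
  ~~ uniq (c :: flatten (map lverts s)).

Hypothesis free : fan_free.

Definition vs2 (T : V * V) := let: (a, b) := T in [:: a; b].
Definition vs3 (T : V * V * V) := let: (a, b, x) := T in [:: a; b; x].
Definition vs4 (T : V * V * V * V) := let: (a, b, x, y) := T in [:: a; b; x; y].

(** Only the outer edges lack expansion vertices; each has [t] candidates off everything in use, so
    [greedy_sdr] supplies them. *)
Lemma no_fan_of_open_triangles c (s : seq (V * V * V * V)) :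
  size s = t -> uniq (c :: flatten (map vs4 s)) ->
  all (fun T : V * V * V * V => let: (a, b, x, y) := T in
    [&& h c a x, h c b y
      & t <= #|nbhd a b :\: [set v in c :: flatten (map vs4 s)]|]) s -> False.
Proof.
move=> sz us As; set X := [set v in c :: flatten _] in As.
have := @greedy_sdr V _ (fun T : V * V * V * V => nbhd T.1.1.1 T.1.1.2) X s.
case.
  by rewrite sz; apply: sub_all As => -[[[a b] x] y] /and3P[].
move=> s' [fs us' all_s].
have szs' : size s' = t by rewrite -sz -fs size_map.
have As' : all (fun p => p.1 \in s) s'.
  by apply/allP=> p ps; rewrite -fs map_f.
have ls' : all (loose c) s'.
  apply/allP=> -[[[[a b] x] y] z] ps.
  move/allP/(_ _ ps): all_s; rewrite !inE /= => /andP[_ habz].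
  by have /and3P[-> -> _] := allP As _ (allP As' _ ps).
apply: (negP (free szs' ls')).
have pe : perm_eq (flatten (map lverts s')) (flatten (map vs4 s) ++ map snd s').
  rewrite -(flatten_map1 snd) -[X in map vs4 X]fs -map_comp.
  rewrite (eq_map (f := lverts) (g := fun p => vs4 p.1 ++ [:: p.2])).
    by apply: perm_flatten_cat.
  by case=> [[[[a b] x] y] z].
rewrite -(perm_cons c) -cat_cons in pe; rewrite (perm_uniq pe) cat_uniq us us' andbT /=.
apply/hasPn=> v /mapP[p ps ->]; have /allP/(_ _ ps) := all_s.
by rewrite in_setD [p.2 \in X]inE => /andP[].
Qed.

(** Here the outer edges are complete and the spokes are expanded in two greedy rounds, avoiding
    [3t + 1] and then [4t + 1] vertices. The second round needs [t] free candidates, whence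
    codegrees above [5t]. *)
Lemma no_fan_of_heavy_pairs c (s : seq (V * V * V)) :
  size s = t -> uniq (c :: flatten (map vs3 s)) ->
  all (fun T : V * V * V => let: (a, b, z) := T in
    [&& h a b z, 5 * t < codeg c a & 5 * t < codeg c b]) s -> False.
Proof.
move=> sz us As; set X := [set v in c :: flatten (map vs3 s)].
have cX : #|X| <= (3 * t).+1.
  apply: leq_trans (card_set_seq _) _; rewrite /= (@size_flatten_const _ _ _ 3) ?sz //.
  by case=> [[? ?] ?].
have big (Y : {set V}) m (A : {set V}) : #|Y| <= m -> m + t <= #|A| -> t <= #|A :\: Y|.
  by move=> cY cA; have := cardsID Y A; have := subset_leq_card (subsetIr A Y); lia.
have := @greedy_sdr V _ (fun T : V * V * V => nbhd c T.1.1) X s.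
case.
  rewrite sz; apply: sub_all As => -[[a b] z] /and3P[_ ca _] /=.
  by apply: big cX _; rewrite /codeg in ca; lia.
move=> s1 [fs1 us1 all1].
pose Y := X :|: [set v in map snd s1].
have szs1 : size s1 = t by rewrite -sz -fs1 size_map.
have cY : #|Y| <= (4 * t).+1.
  rewrite /Y; have := card_set_seq (map snd s1); rewrite size_map szs1.
  by have := (leq_card_setU X [set v in map snd s1]).1; lia.
have As1 : all (fun p => p.1 \in s) s1.
  by apply/allP=> p ps; rewrite -fs1 map_f.
have := @greedy_sdr V _ (fun T : V * V * V * V => nbhd c T.1.1.2) Y s1.
case.
  rewrite szs1; apply/allP=> -[[[a b] z] x] /(allP As1)/(allP As) /= /and3P[_ _ cb].
  by apply: big cY _; rewrite /codeg in cb; lia.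
move=> s2 [fs2 us2 all2].
have As2 : all (fun p => p.1 \in s1) s2.
  by apply/allP=> p ps; rewrite -fs2 map_f.
pose g (p : V * V * V * V * V) : V * V * V * V * V :=
  let: (a, b, z, x, y) := p in (a, b, x, y, z).
have szs2 : size (map g s2) = t by rewrite size_map -szs1 -fs2 size_map.
have ls2 : all (loose c) (map g s2).
  rewrite all_map; apply/allP=> -[[[[a b] z] x] y] ps /=.
  have ps1 := allP As2 _ ps; have /and3P[habz _ _] := allP As _ (allP As1 _ ps1).
  rewrite habz andbT; apply/andP; split.
    by move/allP/(_ _ ps1): all1; rewrite !inE /= => /andP[].
  by move/allP/(_ _ ps): all2; rewrite !inE /= => /andP[].
apply: (negP (free szs2 ls2)).
have pe : perm_eq (flatten (map lverts (map g s2)))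
    ((flatten (map vs3 s) ++ map snd s1) ++ map snd s2).
  have -> : map vs3 s = [seq vs3 p.1.1 | p <- s2] by rewrite -fs1 -fs2 -!map_comp.
  have -> : map snd s1 = [seq p.1.2 | p <- s2] by rewrite -fs2 -map_comp.
  rewrite -(flatten_map1 (fun p => p.1.2)) -(flatten_map1 snd s2) -map_comp.
  apply: perm_trans (_ : perm_eq (flatten
      [seq (vs3 p.1.1 ++ [:: p.1.2]) ++ [:: p.2] | p <- s2]) _).
    apply: perm_flatten_map => -[[[[a b] z] x] y] /=.
    by rewrite !perm_cons (perm_catC [:: x; y] [:: z]).
  apply: perm_trans (perm_flatten_cat _ _ _) _; rewrite perm_cat2r.
  exact: perm_flatten_cat.
rewrite -(perm_cons c) -!cat_cons in pe; rewrite (perm_uniq pe) !cat_uniq us us1 us2 !andbT /=.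
apply/andP; split; apply/hasPn=> v /mapP[p ps ->].
  have /allP/(_ _ ps) := all1.
  by rewrite in_setD [p.2 \in X]inE => /andP[].
have /allP/(_ _ ps) := all2; rewrite in_setD => /andP[+ _].
by rewrite in_setU [_ \in X]inE [_ \in [set _ in map snd s1]]inE -mem_cat.
Qed.

Definition is_cover c (X : {set V}) := #|X| <= 5 * t /\
  forall T, loose c T -> uniq (c :: lverts T) -> has (mem X) (lverts T).

Lemma loose_triangle_cover c : exists X, is_cover c X.
Proof.
pose P T := loose c T && uniq (c :: lverts T).
have := @disjoint_or_cover V _ lverts P 5 t; case.
- by move=> T /andP[_] /=; case/andP.
- by case=> [[[[? ?] ?] ?] ?].
- case=> s [sz Ps us].
  have ls : all (loose c) s by apply: sub_all Ps => T /andP[].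
  case: (negP (free sz ls)).
  rewrite /= us andbT; apply/flattenP=> -[l /mapP[T Ts ->]] cT.
  by have /andP[_ /=] := allP Ps _ Ts; rewrite cT.
- case=> X [cX hX]; exists X; split=> // T lT uT; apply: hX; exact/andP.
Qed.

(** The threshold leaves an extension vertex off a cover of at most [5t] vertices and off three
    further ones ([heavy_ext]). *)
Definition heavyp x y := 5 * t + 4 <= codeg x y.

Lemma heavyC x y : heavyp x y = heavyp y x.
Proof. by rewrite /heavyp cdC. Qed.

Definition Nh z : {set V} := [set x | heavyp z x].

Lemma exists_notin (A X : {set V}) : #|X| < #|A| -> exists2 v, v \in A & v \notin X.
Proof.
move=> XA; have /card_gt0P[v] : 0 < #|A :\: X|.
  by have := cardsID X A; have := subset_leq_card (subsetIr A X); lia.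
by rewrite inE => /andP[]; exists v.
Qed.

Lemma heavy_ext (X : {set V}) x y l : #|X| <= 5 * t -> heavyp x y -> size l <= 3 ->
  exists v, [/\ h x y v, v \notin X & v \notin l].
Proof.
move=> cX hxy sl; have [|v vA] := @exists_notin (nbhd x y) (X :|: [set v in l]).
  apply: leq_ltn_trans (leq_card_setU _ _).1 _; rewrite /heavyp /codeg in hxy.
  apply: leq_trans hxy; rewrite -addnS leq_add //.
  exact: leq_ltn_trans (card_set_seq l) _.
rewrite inE in vA; rewrite in_setU [v \in [set _ in l]]inE negb_or => /andP[vX vl].
by exists v.
Qed.

(** The heavy pairs become spokes whose expansion vertices [p], [q] avoid the cover, so the cover
    can hit this loose triangle only in [x], [y] or [w]. *)
Lemma cover_heavy z X x y w : is_cover z X -> heavyp z x -> heavyp z y -> h x y w ->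
  w != z -> [|| x \in X, y \in X | w \in X].
Proof.
case=> cX hX zx zy xyw wz.
have [xy xw yw] := h_distinct xyw.
have [p [zxp pX pl]] := heavy_ext cX zx (isT : size [:: y; w] <= 3).
have [q [zyq qX ql]] := heavy_ext cX zy (isT : size [:: x; w; p] <= 3).
have [zx' zp xp] := h_distinct zxp; have [zy' zq yq] := h_distinct zyq.
have := hX (x, y, p, q, w); rewrite /= zxp zyq xyw => /(_ isT).
have -> : [|| x \in X, y \in X, p \in X, q \in X, w \in X | false] =
  [|| x \in X, y \in X | w \in X] by rewrite (negbTE pX) (negbTE qX) orbF.
apply; rewrite !inE !negb_or zx' zy' zp zq xy xp xw yq yw [z == w]eq_sym wz /=.
move: pl ql; rewrite !inE !negb_or => /andP[py pw] /and3P[qx qw qp].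
by rewrite [y == p]eq_sym [x == q]eq_sym [p == q]eq_sym py qx qp pw qw.
Qed.

Lemma heavy_neq x y : heavyp x y -> x != y.
Proof.
rewrite /heavyp => hxy; have /card_gt0P[v] : 0 < codeg x y by lia.
by rewrite inE; apply: hneq.
Qed.

(** [X] separates the ends of the outer edges, which lie off it, from the apexes, which lie in it.
    Hence distinctness is required only within each family. *)
Lemma no_fan_of_apexes c (X : {set V}) (s : seq (V * V * V)) :
  size s = t -> uniq (flatten (map vs2 (map fst s))) -> uniq (map snd s) ->
  (forall a b w, (a, b, w) \in s ->
    [&& h a b w, heavyp c a, heavyp c b, a \notin X, b \notin X, w \in X & w != c]) -> False.
Proof.
move=> sz us uw sP; apply: (@no_fan_of_heavy_pairs c s sz) => [|]; last first.
  apply/allP=> -[[a b] w] /sP /and3P[-> ca /andP[cb _]].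
  by move: ca cb; rewrite /heavyp; lia.
have pe : perm_eq (flatten (map vs3 s)) (flatten (map vs2 (map fst s)) ++ map snd s).
  rewrite -(flatten_map1 snd) -map_comp.
  apply: perm_trans (perm_flatten_cat _ _ _).
  by apply: perm_flatten_map => -[[a b] w].
rewrite -(perm_cons c) in pe; rewrite (perm_uniq pe) /= mem_cat negb_or cat_uniq us uw andbT /=.
apply/andP; split; first apply/andP; first split.
- apply/flatten_mapP=> -[p /mapP[[[a b] w] /sP /and5P[_ ca cb _ _] ->]].
  by rewrite !inE (negbTE (heavy_neq ca)) (negbTE (heavy_neq cb)).
- apply/mapP=> -[[[a b] w] /sP /and5P[_ _ _ _ /and3P[_ _ cw]]] e.
  by rewrite e eqxx in cw.
- apply/hasPn=> w' /mapP[[[a b] w] /sP /and5P[_ _ _ _ /and3P[_ wX _]] ->] /=.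
  apply/flatten_mapP=> -[p /mapP[[[a' b'] w''] /sP /and5P[_ _ _ aX /andP[bX _]] ->]].
  by rewrite !inE => /orP[] /eqP e; rewrite -e wX in aX bX.
Qed.

End Basics.
Arguments vs2 {V}.
Arguments vs3 {V}.
Arguments vs4 {V}.
Arguments lverts {V}.

(** * Hyperedges with two light pairs at a vertex *)

Lemma card_set_in_sum (T : finType) (I : {set T}) (P : pred T) :
  #|[set j in I | P j]| = \sum_(j in I) (P j : nat).
Proof. by rewrite -sum1dep_card big_mkcondr /=; apply: eq_bigr => j _; case: (P j). Qed.

Lemma card_set_sum (T : finType) (P : pred T) : #|[set j | P j]| = \sum_j (P j : nat).
Proof. by rewrite -sum1dep_card big_mkcond /=; apply: eq_bigr => j _; case: (P j). Qed.

(** Indegrees and outdegrees have the same sum, so some vertex has indegree at most [k]; keeping it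
    discards at most [2k + 1] vertices. *)
Lemma sparse_digraph_indep (T : finType) (I : {set T}) (r : rel T) k t :
  (forall i, i \in I -> #|[set j in I | r i j]| <= k) -> t * (2 * k).+1 <= #|I| ->
  exists s, [/\ size s = t, uniq s, all (mem I) s
    & {in s &, forall i j, i != j -> ~~ r i j}].
Proof.
elim: t I => [|t IH] I outk; first by exists [::].
rewrite mulSn => cI.
have: [exists i in I, #|[set j in I | r j i]| <= k].
  apply: contraLR cI => /exists_inPn ink; rewrite -ltnNge.
  suff -> : #|I| = 0 by lia.
  have e : \sum_(i in I) #|[set j in I | r i j]| = \sum_(i in I) #|[set j in I | r j i]|.
    under eq_bigr do rewrite card_set_in_sum.
    rewrite exchange_big /=; apply: eq_bigr => i _.
    by rewrite card_set_in_sum.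
  have u : \sum_(i in I) #|[set j in I | r i j]| <= #|I| * k.
    by rewrite -sum_nat_const; apply: leq_sum.
  have l : #|I| * k.+1 <= \sum_(i in I) #|[set j in I | r j i]|.
    by rewrite -sum_nat_const; apply: leq_sum => i /ink; rewrite -ltnNge.
  by rewrite e in u; have := leq_trans l u; rewrite mulnS; lia.
case/exists_inP=> i iI ini.
pose I' := I :\: ([set i] :|: [set j in I | r i j] :|: [set j in I | r j i]).
have [||s [sz us sI' ind]] := IH I'.
- move=> j; rewrite inE => /andP[_ jI]; apply: leq_trans (outk _ jI).
  apply: subset_leq_card; apply/subsetP=> l; rewrite !inE => /andP[/andP[_ ->]] //.
- have c1 := (leq_card_setU ([set i] :|: [set j in I | r i j]) [set j in I | r j i]).1.
  have c2 := (leq_card_setU [set i] [set j in I | r i j]).1.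
  rewrite cards1 in c2; have := outk _ iI.
  set X := _ :|: _ in c1 *; have := cardsID X I.
  have := subset_leq_card (subsetIr I X); rewrite -/I'; lia.
exists (i :: s); split=> /=.
- by rewrite sz.
- rewrite us andbT; apply/negP=> /(allP sI').
  by rewrite /= !inE eqxx.
- rewrite iI; apply: sub_all sI' => j /=; rewrite inE => /andP[] //.
- have nr j : j \in s -> ~~ r i j && ~~ r j i.
    move/(allP sI'); rewrite /= !inE !negb_or -!andbA => /and4P[_ + + jI].
    by rewrite jI /= => -> ->.
  move=> j l; rewrite !inE => /predU1P[->|js] /predU1P[->|ls].
  + by rewrite eqxx.
  + by case/andP: (nr _ ls).
  + by case/andP: (nr _ js).
  + exact: ind.
Qed.

Lemma card_bigcup_leq (I T : finType) (B : {set I}) (F : I -> {set T}) m :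
  (forall i, i \in B -> #|F i| <= m) -> #|\bigcup_(i in B) F i| <= #|B| * m.
Proof.
move=> Fm; apply: leq_trans (_ : \sum_(i in B) #|F i| <= _).
  elim/big_rec2: _ => [|i x y _ le]; first by rewrite cards0.
  by apply: leq_trans (leq_card_setU _ _).1 _; rewrite leq_add2l.
by rewrite -sum_nat_const; apply: leq_sum.
Qed.

Lemma uniq_flatten_disjoint (T I : eqType) (f : I -> seq T) (s : seq I) :
  uniq s -> {in s, forall i, uniq (f i)} ->
  {in s &, forall i j, i != j -> ~~ has (mem (f i)) (f j)} ->
  uniq (flatten (map f s)).
Proof.
elim: s => //= i s IH /andP[is_ us] uf df; rewrite cat_uniq uf ?mem_head //.
rewrite IH //=; last first.
- by move=> j l js ls; apply: df; rewrite inE ?js ?ls orbT.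
- by move=> j js; apply: uf; rewrite inE js orbT.
rewrite andbT; apply/hasPn=> x /flatten_mapP[j js xj].
have ij : i != j by apply: contraNneq is_ => ->.
have := df i j (mem_head _ _) _ ij; rewrite inE js orbT => /(_ isT)/hasPn/(_ _ xj).
by [].
Qed.

Section Few.
Variables (V : finType) (h : threegraph V) (t D : nat).
Hypothesis free : fan_free h t.
Hypothesis tD : 5 * t < D.
Hypothesis t_gt1 : 1 < t.
Variable c : V.
Local Notation nb := (nbhd h).
Local Notation cd := (codeg h).

(** The light graph in the link of [c]: its edges are the hyperedges at [c] with two light pairs
    there, and its degrees are at most [D]. *)
Definition adj u v := [&& h c u v, cd c u < D & cd c v < D].
Definition adjs u : {set V} := [set v | adj u v].

Lemma adjC u v : adj u v = adj v u.
Proof. by rewrite /adj hA; case: (h c v u) => //=; rewrite andbC. Qed.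

Lemma card_adjs u : #|adjs u| <= D.
Proof.
case: (ltnP (cd c u) D) => [cu|cu].
  apply: leq_trans (ltnW cu); apply: subset_leq_card.
  by apply/subsetP=> v; rewrite !inE /adj => /and3P[].
rewrite (_ : adjs u = set0) ?cards0 //; apply/setP=> v.
by rewrite !inE /adj ltnNge cu andbF.
Qed.

Lemma adj_neq u v : adj u v -> [/\ c != u, c != v & u != v].
Proof. by case/and3P=> /h_distinct[]. Qed.

Definition ball v := v |: (adjs v :|: \bigcup_(u in adjs v) adjs u).

Lemma card_ball v : #|ball v| <= (D + D * D).+1.
Proof.
have c1 := card_adjs v.
have c2 : #|\bigcup_(u in adjs v) adjs u| <= D * D.
  apply: leq_trans (card_bigcup_leq (m := D) _) _; last by rewrite leq_mul2r c1 orbT.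
  by move=> u _; apply: card_adjs.
have c3 := (leq_card_setU (adjs v) (\bigcup_(u in adjs v) adjs u)).1.
by rewrite /ball cardsU1; case: (_ \notin _); lia.
Qed.

(** The size that [sparse_digraph_indep] asks for: a pair forbids its 4 core vertices and at most
    [D] neighbours, and each of these lies in at most [(D + D * D).+1 * D] cores. *)
Definition few_bound := t * (2 * ((D + 4) * ((D + D * D).+1 * D))).+1.

Section GeneralPosition.
Variables (I : {set V * V}) (fx fy : V * V -> V).
Hypothesis Iab : forall p, p \in I -> adj p.1 p.2.
Hypothesis Ix : forall p, p \in I -> adj p.1 (fx p).
Hypothesis Iy : forall p, p \in I -> (fy p == p.2) || adj p.2 (fy p).

(** An open triangle at [c]. The degenerate value [fy p = p.2] serves triangles whose second spoke
    is expanded by a vertex chosen separately. *)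
Definition core p := [:: p.1; p.2; fx p; fy p].

(** All core vertices lie within distance 2 of the first end [a] in the light graph, so [a] lies in
    [ball v]; then [b] is one of at most [D] neighbours of [a]. *)
Lemma card_core_through v : #|[set q in I | v \in core q]| <= (D + D * D).+1 * D.
Proof.
pose F a : {set V * V} := [set (a, b) | b in adjs a].
apply: leq_trans (_ : #|\bigcup_(a in ball v) F a| <= _).
  apply: subset_leq_card; apply/subsetP=> -[a b]; rewrite inE => /andP[qI vq].
  have ab := Iab qI; have ax := Ix qI; have by_ := Iy qI; rewrite /= in ab ax by_.
  apply/bigcupP; exists a; last by apply: imset_f; rewrite inE.
  move: vq; rewrite !inE => /or4P[] /eqP e.
  - by rewrite e eqxx.
  - by rewrite e /= adjC ab /= !orbT.
  - by rewrite e /= adjC ax /= !orbT.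
  - case/predU1P: by_ => [e'|by_]; first by rewrite e e' adjC ab !orbT.
    apply/or3P/Or33/bigcupP; exists b; by rewrite inE ?e adjC.
apply: leq_trans (card_bigcup_leq (m := D) _) _; last by rewrite leq_mul2r card_ball orbT.
by move=> a _; apply: leq_trans (leq_imset_card _ _) (card_adjs a).
Qed.

(** Besides disjoint cores, the neighbourhood of a light outer pair must avoid the other cores: its
    expansion vertex is then obstructed only by its own triangle. *)
Lemma general_position : few_bound <= #|I| ->
  exists s, [/\ size s = t, uniq s, {in s, forall p, p \in I},
    {in s &, forall p q, p != q -> ~~ has (mem (core p)) (core q)}
    & {in s &, forall p q, p != q -> cd p.1 p.2 < D ->
        ~~ has (mem (nb p.1 p.2)) (core q)}].
Proof.
pose forb p : {set V} := [set v in core p] :|: (if cd p.1 p.2 < D then nb p.1 p.2 else set0).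
pose r p q := has (mem (forb p)) (core q).
have cf p : #|forb p| <= D + 4.
  apply: leq_trans (leq_card_setU _ _).1 _; rewrite addnC leq_add //.
    by case: ifP => [/ltnW|] //; rewrite cards0.
  exact: card_set_seq.
case/(@sparse_digraph_indep _ I r ((D + 4) * ((D + D * D).+1 * D))).
  move=> p pI; apply: leq_trans (_ : #|\bigcup_(v in forb p) [set q in I | v \in core q]| <= _).
    apply: subset_leq_card; apply/subsetP=> q; rewrite inE => /andP[qI /hasP[v vq vp]].
    by apply/bigcupP; exists v => //; rewrite inE qI.
  apply: leq_trans (card_bigcup_leq (m := (D + D * D).+1 * D) _) _.
    by move=> v _; apply: card_core_through.
  by rewrite leq_mul2r cf orbT.
move=> s [sz us sI ind]; exists s; split=> //.
- by move=> p /(allP sI).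
- move=> p q ps qs pq; apply: contra (ind p q ps qs pq); apply: sub_has => v /=.
  by rewrite /forb in_setU [v \in [set _ in _]]inE => ->.
- move=> p q ps qs pq lt; apply: contra (ind p q ps qs pq); apply: sub_has => v /=.
  by rewrite /forb in_setU lt => ->; rewrite orbT.
Qed.

End GeneralPosition.

(** Both spokes can be expanded by light neighbours belonging to the pair alone. *)
Definition two_private (p : V * V) := [&& adj p.1 p.2, 2 * t + 2 <= cd p.1 p.2 &
  [exists q : V * V, [&& adj p.1 q.1, adj p.2 q.2, q.1 != p.2, q.2 != p.1 & q.1 != q.2]]].

(** Here the spoke at [b] is expanded by a vertex heavy towards [c]. Many pairs may share these
    vertices, so [greedy_sdr] distributes them. The threshold [2t + 2] stems from this case: [c],
    one light vertex and [t] heavy ones are avoided, and [t] candidates remain. *)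
Definition private_common (p : V * V) := [&& adj p.1 p.2, 2 * t + 2 <= cd p.1 p.2,
  [exists x, adj p.1 x && (x != p.2)] & t <= #|[set w in nb c p.2 | D <= cd c w]|].

Lemma card_setD_seq (A : {set V}) (l l' : seq V) m :
  (forall v, v \in A -> v \in l -> v \in l') -> size l' + m <= #|A| ->
  m <= #|A :\: [set v in l]|.
Proof.
move=> sub le; have : #|A :&: [set v in l]| <= size l'.
  apply: leq_trans (card_set_seq l'); apply: subset_leq_card; apply/subsetP=> v.
  by rewrite !inE => /andP[]; apply: sub.
by have := cardsID [set v in l] A; lia.
Qed.

Lemma few_two_private : #|[set p | two_private p]| < few_bound.
Proof.
rewrite ltnNge; apply/negP.
pose Q (p q : V * V) := [&& adj p.1 q.1, adj p.2 q.2, q.1 != p.2, q.2 != p.1 & q.1 != q.2].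
pose f p := odflt p [pick q | Q p q].
have fP p : two_private p -> Q p (f p).
  case/and3P=> _ _ /existsP[q pq]; rewrite /f; case: pickP => //= /(_ q).
  by rewrite /Q pq.
case/(@general_position _ (fun p => (f p).1) (fun p => (f p).2)).
- by move=> p; rewrite inE => /and3P[].
- by move=> p; rewrite inE => /fP/and5P[].
- by move=> p; rewrite inE => /fP/and5P[_ ->]; rewrite orbT.
move=> s [sz us sI ds ns].
set co := core _ _ in ds ns.
have e : map vs4 [seq (p.1, p.2, (f p).1, (f p).2) | p <- s] = map co s.
  by rewrite -map_comp.
have ufl : uniq (c :: flatten (map co s)).
  rewrite /= uniq_flatten_disjoint ?andbT //.
    apply/flatten_mapP=> -[p /sI]; rewrite inE => tp.
    have /and5P[ax by_ _ _ _] := fP _ tp; have /and3P[ab _ _] := tp.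
    have [ca cb _] := adj_neq ab; have [_ cx _] := adj_neq ax; have [_ cy _] := adj_neq by_.
    by rewrite !inE (negbTE ca) (negbTE cb) (negbTE cx) (negbTE cy).
  move=> p /sI; rewrite inE => tp.
  have /and5P[ax by_ xb ya xy] := fP _ tp; have /and3P[ab _ _] := tp.
  have [_ _ nab] := adj_neq ab; have [_ _ nax] := adj_neq ax; have [_ _ nby] := adj_neq by_.
  by rewrite /= !inE !negb_or nab nax nby xy eq_sym ya eq_sym xb.
apply: (@no_fan_of_open_triangles _ _ _ free c [seq (p.1, p.2, (f p).1, (f p).2) | p <- s]).
- by rewrite size_map.
- by rewrite e.
rewrite e all_map; apply/allP=> -[a b] ps /=; have := sI _ ps; rewrite inE => tp.
have /and5P[/and3P[hax _ _] /and3P[hby _ _] _ _ _] := fP _ tp.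
rewrite hax hby /=; have /and3P[_ /= ab _] := tp.
(* A heavy outer pair keeps [t] candidates off all [4t + 1] vertices in use because [5t < D]; a
   light one meets no other core, so only [c] and its own two spoke vertices are in the way. *)
case: (ltnP (cd a b) D) => [lt|ge]; last first.
  apply: (@card_setD_seq _ _ (c :: flatten (map co s))) => //=.
  by rewrite (@size_flatten_const _ _ _ 4) // sz; rewrite /codeg in ge; lia.
apply: (@card_setD_seq _ _ [:: c; (f (a, b)).1; (f (a, b)).2]) => [v vab|/=]; last first.
  by rewrite /codeg in ab; lia.
rewrite inE => /predU1P[->|/flatten_mapP[q qs vq]]; first by rewrite mem_head.
have vab' := vab; rewrite inE in vab'; have [_ av bv] := h_distinct vab'.
case: (eqVneq (a, b) q) => [eq|nq].
  move: vq; rewrite -eq !inE /= [v == a]eq_sym [v == b]eq_sym (negbTE av) (negbTE bv) /=.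
  by move=> ->; rewrite orbT.
by have /hasPn/(_ _ vq) := ns _ _ ps qs nq lt; rewrite /= vab.
Qed.

Lemma few_private_common : #|[set p | private_common p]| < few_bound.
Proof.
rewrite ltnNge; apply/negP.
pose Q (p : V * V) x := adj p.1 x && (x != p.2).
pose f p := odflt p.1 [pick x | Q p x].
have fP p : private_common p -> Q p (f p).
  case/and4P=> _ _ /existsP[x px] _; rewrite /f; case: pickP => //= /(_ x).
  by rewrite /Q px.
case/(@general_position _ f snd).
- by move=> p; rewrite inE => /and4P[].
- by move=> p; rewrite inE => /fP/andP[].
- by move=> p; rewrite eqxx.
move=> s [sz us sI ds ns].
have [|s' [fs us' As']] := @greedy_sdr V _ (fun p => [set w in nb c p.2 | D <= cd c w]) set0 s.
  apply/allP=> p /sI; rewrite inE => /and4P[_ _ _]; rewrite sz setD0; exact.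
pose g (p : V * V * V) := (p.1.1, p.1.2, f p.1, p.2).
have s'I p : p \in s' -> p.1 \in s by move=> ps; rewrite -fs map_f.
have lightc p v : p \in s -> v \in [:: p.1; p.2; f p] -> cd c v < D.
  move/sI; rewrite inE => pc; have /andP[/and3P[_ _ cx] _] := fP _ pc.
  have /and4P[/and3P[_ ca cb] _ _ _] := pc.
  by rewrite !inE => /or3P[] /eqP ->.
have heavyw p : p \in s' -> h c p.1.2 p.2 /\ D <= cd c p.2.
  by move/(allP As'); rewrite setD0 !inE => /andP[].
have pe : perm_eq (flatten (map vs4 (map g s')))
    (flatten (map (fun p => [:: p.1; p.2; f p]) s) ++ map snd s').
  have -> : [seq [:: p.1; p.2; f p] | p <- s] = [seq [:: p.1.1; p.1.2; f p.1] | p <- s'].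
    by rewrite -fs -map_comp.
  rewrite -(flatten_map1 snd) -map_comp.
  apply: perm_trans (perm_flatten_cat _ _ _).
  by apply: perm_flatten_map => -[[a b] w].
have ufl : uniq (c :: flatten (map vs4 (map g s'))).
  rewrite -(perm_cons c) -cat_cons in pe; rewrite (perm_uniq pe) cat_uniq us' andbT.
  apply/andP; split.
    rewrite /= uniq_flatten_disjoint ?andbT //.
    + apply/flatten_mapP=> -[p /sI]; rewrite inE => tp.
      have /andP[ax _] := fP _ tp; have /and4P[ab _ _ _] := tp.
      have [ca cb _] := adj_neq ab; have [_ cx _] := adj_neq ax.
      by rewrite !inE (negbTE ca) (negbTE cb) (negbTE cx).
    + move=> p /sI; rewrite inE => tp.
      have /andP[ax xb] := fP _ tp; have /and4P[ab _ _ _] := tp.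
      have [_ _ nab] := adj_neq ab; have [_ _ nax] := adj_neq ax.
      by rewrite /= !inE !negb_or nab nax eq_sym xb.
    + move=> p q ps qs pq; apply: contra (ds p q ps qs pq) => /hasP[v vq vp].
      apply/hasP; exists v; move: vq vp; rewrite /= !inE.
        by case/or3P=> ->; rewrite ?orbT.
      by move=> _ /or3P[] ->; rewrite ?orbT.
  (* The chosen [w] are heavy towards [c] and core vertices are light, so they never coincide. *)
  apply/hasPn=> w /mapP[p ps ->]; have [hw Dw] := heavyw _ ps.
  rewrite inE negb_or; have [_ cw _] := h_distinct hw; rewrite eq_sym cw /=.
  apply/flatten_mapP=> -[q qs wq]; have := lightc q _ qs wq.
  by rewrite ltnNge Dw.
apply: (@no_fan_of_open_triangles _ _ _ free c (map g s')) => //.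
  by rewrite size_map -sz -fs size_map.
rewrite all_map; apply/allP=> -[[a b] w] ps /=; have := sI _ (s'I _ ps); rewrite inE => tp.
have /andP[/and3P[hax _ _] _] := fP _ tp; have [hbw _] := heavyw _ ps.
rewrite hax hbw /=; have /and4P[_ /= ab _ _] := tp.
have szs' : size s' = t by rewrite -sz -fs size_map.
case: (ltnP (cd a b) D) => [lt|ge]; last first.
  apply: (@card_setD_seq _ _ (c :: flatten (map vs4 (map g s')))) => //=.
  rewrite (@size_flatten_const _ _ _ 4) ?size_map ?szs'; last by case=> [[[? ?] ?] ?].
  by rewrite /codeg in ge; lia.
apply: (@card_setD_seq _ _ (c :: f (a, b) :: map snd s')) => [v vab|/=]; last first.
  by rewrite size_map szs'; rewrite /codeg in ab; lia.
rewrite inE (perm_mem pe) mem_cat => /predU1P[->|/orP[/flatten_mapP[q qs vq]|vs]].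
- by rewrite mem_head.
- have vab' := vab; rewrite inE in vab'; have [_ av bv] := h_distinct vab'.
  case: (eqVneq (a, b) q) => [eq|nq].
    move: vq; rewrite -eq !inE /= [v == a]eq_sym [v == b]eq_sym (negbTE av) (negbTE bv) /=.
    by move=> ->; rewrite orbT.
  have vc : v \in core f snd q by move: vq; rewrite !inE => /or3P[] ->; rewrite ?orbT.
  by have /hasPn/(_ _ vc) := ns _ _ (s'I _ ps) qs nq lt; rewrite /= vab.
- by rewrite !inE vs !orbT.
Qed.

End Few.

(** * Discharging *)

Lemma sum3_rot (V : finType) (F : V -> V -> V -> nat) :
  \sum_x \sum_y \sum_z F y z x = \sum_x \sum_y \sum_z F x y z.
Proof.
rewrite exchange_big /=; apply: eq_bigr => y _.
by rewrite exchange_big.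
Qed.

Lemma sum3_swap23 (V : finType) (F : V -> V -> V -> nat) :
  \sum_x \sum_y \sum_z F x z y = \sum_x \sum_y \sum_z F x y z.
Proof. by apply: eq_bigr => x _; rewrite exchange_big. Qed.

Lemma sum3_swap12 (V : finType) (F : V -> V -> V -> nat) :
  \sum_x \sum_y \sum_z F y x z = \sum_x \sum_y \sum_z F x y z.
Proof. by rewrite exchange_big. Qed.

Lemma leq_sum3 (V : finType) (F G : V -> V -> V -> nat) :
  (forall x y z, F x y z <= G x y z) ->
  \sum_x \sum_y \sum_z F x y z <= \sum_x \sum_y \sum_z G x y z.
Proof. by move=> FG; do 3!apply: leq_sum => ? _. Qed.

Lemma leq_sum2 (V : finType) (F G : V -> V -> nat) :
  (forall x y, F x y <= G x y) -> \sum_x \sum_y F x y <= \sum_x \sum_y G x y.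
Proof. by move=> FG; do 2!apply: leq_sum => ? _. Qed.

Lemma sum3D (V : finType) (F G : V -> V -> V -> nat) :
  \sum_x \sum_y \sum_z (F x y z + G x y z) =
  \sum_x \sum_y \sum_z F x y z + \sum_x \sum_y \sum_z G x y z.
Proof.
rewrite -big_split /=; apply: eq_bigr => x _; rewrite -big_split /=.
by apply: eq_bigr => y _; rewrite -big_split.
Qed.

Lemma sum2D (V : finType) (F G : V -> V -> nat) :
  \sum_x \sum_y (F x y + G x y) = \sum_x \sum_y F x y + \sum_x \sum_y G x y.
Proof. by rewrite -big_split /=; apply: eq_bigr => x _; rewrite -big_split. Qed.

Lemma sum3Z (V : finType) k (F : V -> V -> V -> nat) :
  \sum_x \sum_y \sum_z k * F x y z = k * \sum_x \sum_y \sum_z F x y z.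
Proof.
rewrite big_distrr /=; apply: eq_bigr => x _; rewrite big_distrr /=.
by apply: eq_bigr => y _; rewrite big_distrr.
Qed.

Lemma sum2Z (V : finType) k (F : V -> V -> nat) :
  \sum_x \sum_y k * F x y = k * \sum_x \sum_y F x y.
Proof. by rewrite big_distrr /=; apply: eq_bigr => x _; rewrite big_distrr. Qed.

Lemma sum2_const (V : finType) k : \sum_(x : V) \sum_(y : V) k = k * (#|V| * #|V|).
Proof. by rewrite !sum_nat_const !cardT -!cardE; lia. Qed.

Lemma sum2_card (V : finType) (P : V -> V -> bool) :
  \sum_x \sum_y (P x y : nat) = #|[set p : V * V | P p.1 p.2]|.
Proof. by rewrite card_set_sum pair_big. Qed.

Section Apex.
Variables (V : finType) (h : threegraph V) (t D : nat).
Hypothesis free : fan_free h t.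
Hypothesis tD : 5 * t + 4 <= D.
Local Notation nb := (nbhd h).
Local Notation cd := (codeg h).

(** Off a cover [X] of [z] no [t] such pairs are disjoint: each has [t] apexes besides [z], all in
    [X] by [cover_heavy], which would give a fan at [z]. So [2t] further vertices cover them, and
    every pair meets a set of at most [7t] vertices. *)
Lemma apex_pairs_le z :
  #|[set p : V * V | [&& D <= cd z p.1, D <= cd z p.2, h p.1 p.2 z & t < cd p.1 p.2]]|
  <= 14 * t * #|[set x | D <= cd z x]|.
Proof.
set B := [set x | D <= _]; set A := [set p | _].
have [X coX] := loose_triangle_cover free z; have [cX hX] := coX.
have hvy x : D <= cd z x -> heavyp h t z x by apply: leq_trans.
pose P (p : V * V) := [&& p \in A, p.1 \notin X & p.2 \notin X].
have := @disjoint_or_cover V _ vs2 P 2 t; case.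
- case=> a b /and3P[]; rewrite inE /= => /and4P[_ _ /h_distinct[ab _ _] _] _ _.
  by rewrite inE ab.
- by case.
- case=> s [sz Ps us].
  have [|s' [fs us' As']] := @greedy_sdr V _ (fun p => nb p.1 p.2) [set z] s.
    apply/allP=> p /(allP Ps) /and3P[]; rewrite inE sz => /and4P[_ _ hz lt] _ _.
    by rewrite -ltnS; apply: leq_trans lt _; rewrite /codeg (cardsD1 z) inE hz add1n.
  case: (@no_fan_of_apexes _ _ _ free z X s').
  + by rewrite -sz -fs size_map.
  + by rewrite fs.
  + by [].
  move=> a b w ps; have : (a, b) \in s by rewrite -fs; apply: (map_f fst ps).
  move/(allP Ps)=> /and3P[]; rewrite inE /= => /and4P[/hvy za /hvy zb abz lt] aX bX.
  have := allP As' _ ps; rewrite !inE /= => /andP[wz abw].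
  rewrite abw za zb aX bX wz andbT /=.
  by have := cover_heavy coX za zb abw wz; rewrite (negbTE aX) (negbTE bX).
case=> Y [cY hY]; pose Z := X :|: Y.
have cZ : #|Z| <= 7 * t by rewrite /Z; have := (leq_card_setU X Y).1; lia.
apply: leq_trans (_ : #|setX Z B :|: setX B Z| <= _).
  apply: subset_leq_card; apply/subsetP=> -[a b] pA; have := pA; rewrite !inE /=.
  case/and4P=> -> -> _ _; rewrite andbT /= orbC -!orbA.
  case aX : (a \in X) => //=; case bX : (b \in X); rewrite ?orbT //=.
  have := hY (a, b); rewrite /P pA /= aX bX => /(_ isT); rewrite orbF => /orP[] ->.
    by rewrite ?orbT.
  by rewrite ?orbT.
apply: leq_trans (leq_card_setU _ _).1 _; rewrite !cardsX.
by have := leq_mul cZ (leqnn #|B|); lia.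
Qed.

End Apex.

Section Discharge.
Variables (V : finType) (h : threegraph V) (t D : nat).
Hypothesis free : fan_free h t.
Hypothesis tD : 5 * t + 4 <= D.
Hypothesis t_gt1 : 1 < t.
Local Notation nb := (nbhd h).
Local Notation cd := (codeg h).

Definition unsat x y z := [&& h x y z, t < cd x y, t < cd y z & t < cd z x].

Definition apex z x y := [&& D <= cd z x, D <= cd z y, h x y z & t < cd x y].

Definition exc c a b := [|| two_private h t D c (a, b), two_private h t D c (b, a),
  private_common h t D c (a, b) | private_common h t D c (b, a)].

(** Given [unsat], the absence of [apex] at all three vertices means that at most one pair has
    codegree [D] or more. *)
Definition regular x y z := [&& unsat x y z,
  ~~ [|| apex x y z, apex y z x | apex z x y] & ~~ [|| exc x y z, exc y z x | exc z x y]].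

Definition small x y z := [&& cd x y <= 2 * t + 1, cd y z <= 2 * t + 1 & cd z x <= 2 * t + 1].

Definition center c a b := [&& cd c a < D, cd c b < D & 2 * t + 2 <= cd a b].

(* The charge sent by the hyperedge [x y z] to the pair [x y]. *)
Definition charge x y z := regular x y z *
  (if small x y z then 2 else if center x y z || center y x z then 3 else 0).

Lemma excC c a b : exc c a b = exc c b a.
Proof.
by rewrite /exc; do 2!case: (two_private _ _ _ _ _); do 2!case: (private_common _ _ _ _ _).
Qed.

(** A small hyperedge gives 2 to each pair. Otherwise its largest pair has codegree at least
    [2t + 2], the other two are light, and each of those receives 3. *)
Lemma regular_charge x y z :
  6 * regular x y z <= charge x y z + charge y z x + charge z x y.
Proof.
have rot a b c : regular a b c = regular b c a.
  rewrite /regular; congr [&& _, ~~ _ & ~~ _].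
  - rewrite /unsat (h_rot h a b c); case: (h b c a) => //=.
    by rewrite andbC -andbA.
  - by rewrite orbC -orbA.
  - by rewrite orbC -orbA.
rewrite /charge -(rot x y z) (rot z x y) -!mulnDr.
case: (boolP (regular x y z)) => [r|_]; last by rewrite muln0.
have /and3P[/and4P[hxyz xy yz zx] na _] := r; rewrite mul1n.
have hyzx : h y z x by rewrite -h_rot.
have hzxy : h z x y by rewrite h_rot.
move: na; rewrite /apex hxyz hyzx hzxy xy yz zx !andbT /small /center.
rewrite (cdC _ x z) (cdC _ y x) (cdC _ z y).
move: (cd x y) (cd y z) (cd z x) xy yz zx => A B C xy yz zx.
by repeat case: ifP => //; lia.
Qed.

Lemma light_split c a : cd c a < D ->
  #|adjs h D c a| + #|[set w in nb c a | D <= cd c w]| = cd c a.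
Proof.
move=> ca; rewrite /codeg -[RHS](cardsID [set w | cd c w < D]); congr (_ + _); apply: eq_card => w.
  by rewrite !inE /adj ca.
by rewrite !inE -leqNgt andbC.
Qed.

Lemma exists_other (A : {set V}) u v : 2 < #|A| -> exists2 x, x \in A & (x != u) && (x != v).
Proof.
move=> cA; have [|x xA] := @exists_notin V A [set u; v].
  by apply: leq_ltn_trans _ cA; rewrite cards2; case: (_ != _).
by rewrite !inE negb_or; exists x.
Qed.

(** Suppose [a] has another light neighbour [x]. Without [private_common], [b] has fewer than [t]
    heavy partners, hence a light neighbour [y] other than [a]. By symmetry [a] has fewer than [t]
    heavy partners and so three light ones; one of them differs from [b] and [y], and [two_private]
    holds. *)
Lemma isolated_at_center c a b : ~~ exc c a b -> center c a b -> h c a b ->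
  t + 2 <= cd c a -> t < cd c b -> forall x, adj h D c a x -> x = b.
Proof.
move=> nexc /and3P[ca cb ab] hcab ca2 cb1 x ax; apply/eqP/negPn/negP=> xb.
have aab : adj h D c a b by rewrite /adj hcab ca cb.
have aba : adj h D c b a by rewrite adjC.
have ba : 2 * t + 2 <= cd b a by rewrite cdC.
move: nexc; rewrite /exc !negb_or => /and4P[n1 _ n3 n4].
have eb : #|[set w in nb c b | D <= cd c w]| < t.
  rewrite ltnNge; apply: contra n3 => eb; rewrite /private_common aab ab eb /= andbT.
  by apply/existsP; exists x; rewrite ax.
have [y yb ya] : exists2 y, adj h D c b y & y != a.
  have [|y] := @exists_notin V (adjs h D c b) [set a].
    by rewrite cards1; have := light_split cb; lia.
  by rewrite !inE; exists y.
have ea : #|[set w in nb c a | D <= cd c w]| < t.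
  rewrite ltnNge; apply: contra n4 => ea; rewrite /private_common aba ba ea /= andbT.
  by apply/existsP; exists y; rewrite yb.
have [|x' x'a /andP[x'b x'y]] := @exists_other (adjs h D c a) b y.
  by have := light_split ca; lia.
rewrite inE in x'a; case/negP: n1; rewrite /two_private aab ab /=.
by apply/existsP; exists (x', y); rewrite /= x'a yb x'b ya.
Qed.

Lemma regular_exc x y z : regular x y z -> ~~ exc x y z /\ ~~ exc y x z.
Proof. by case/and3P=> _ _ /norP[e1 /norP[e2 _]]; rewrite (excC y x). Qed.

(** At codegree [t + 1] the charge is at most [3(t + 1)]. Beyond that, [isolated_at_center] allows
    one centred hyperedge at each of [x] and [y], and none beside a small hyperedge. This leaves at
    most 6, or at most [2(2t + 1)] from small ones; the latter equals [6t - 2] for [t = 2]. *)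
Lemma pair_charge_le x y : \sum_z charge x y z <= (6 * t - 2) * (t < cd x y).
Proof.
case: (leqP (cd x y) t) => [le|gt].
  rewrite big1 // => z _; rewrite /charge /regular /unsat.
  by rewrite [t < cd x y]ltnNge le andbF.
have hsup z : regular x y z -> h x y z by case/and3P=> /and4P[].
rewrite muln1; case: (ltnP (cd x y) (t + 2)) => [lt|ge].
  apply: leq_trans (_ : \sum_z 3 * h x y z <= _).
    apply: leq_sum => z _; rewrite /charge.
    case: (boolP (regular x y z)) => // /hsup ->; rewrite mul1n.
    by case: ifP => // _; case: ifP.
  rewrite -big_distrr /= -card_set_sum -[#|_|]/(cd x y); lia.
pose Zs := [set z | regular x y z && small x y z].
pose Zx := [set z | regular x y z && center x y z].
pose Zy := [set z | regular x y z && center y x z].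
have le : \sum_z charge x y z <= 2 * #|Zs| + 3 * #|Zx| + 3 * #|Zy|.
  rewrite !card_set_sum !big_distrr -!big_split /=; apply: leq_sum => z _.
  rewrite /charge; case: (regular x y z) => //=; rewrite mul1n.
  by case: (small x y z) => //=; case: (center x y z) => //=; case: (center y x z).
have adjx z z' : regular x y z -> center x y z -> h x y z' -> cd x z' < D -> z' = z.
  move=> r ce hz' lz'; have [e1 _] := regular_exc r; have /and3P[/and4P[hz _ _ zx] _ _] := r.
  apply: (isolated_at_center e1 ce hz ge _); first by rewrite cdC.
  by have /and3P[l1 _ _] := ce; rewrite /adj hz' l1.
have adjy z z' : regular x y z -> center y x z -> h x y z' -> cd y z' < D -> z' = z.
  move=> r ce hz' lz'; have [_ e1] := regular_exc r; have /and3P[/and4P[hz _ yz _] _ _] := r.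
  rewrite hC in hz; rewrite cdC in ge; apply: (isolated_at_center e1 ce hz ge yz).
  by have /and3P[l1 _ _] := ce; rewrite /adj hC hz' l1.
have cx : #|Zx| <= 1.
  apply/card_le1_eqP=> z z'; rewrite !inE => /andP[r c] /andP[r' c'].
  by apply: (adjx _ _ r c (hsup _ r')); have /and3P[] := c'.
have cy : #|Zy| <= 1.
  apply/card_le1_eqP=> z z'; rewrite !inE => /andP[r c] /andP[r' c'].
  by apply: (adjy _ _ r c (hsup _ r')); have /and3P[] := c'.
case: (set_0Vmem Zs) => [e|[z]]; first by rewrite e cards0 in le; lia.
rewrite inE => /andP[rz /and3P[sxy syz szx]].
have ex : Zx = set0.
  apply/setP=> z'; rewrite !inE; apply/negP=> /andP[r' c'].
  have e : z = z'.
    by apply: (adjx _ _ r' c' (hsup _ rz)); rewrite cdC; apply: leq_ltn_trans szx _; lia.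
  by case/and3P: c' => _ _; rewrite -e; lia.
have ey : Zy = set0.
  apply/setP=> z'; rewrite !inE; apply/negP=> /andP[r' c'].
  have e : z = z'.
    by apply: (adjy _ _ r' c' (hsup _ rz)); apply: leq_ltn_trans syz _; lia.
  by case/and3P: c' => _ _; rewrite -e (cdC _ x z); lia.
have cs : #|Zs| <= cd x y.
  by apply: subset_leq_card; apply/subsetP=> w; rewrite !inE => /andP[/hsup].
by rewrite ex ey cards0 in le; lia.
Qed.

Lemma sum_regular_le : \sum_x \sum_y \sum_z (regular x y z : nat) <=
  (3 * t - 1) * \sum_x \sum_y (t < cd x y : nat).
Proof.
have := @leq_sum3 V _ _ regular_charge.
rewrite sum3Z !sum3D (sum3_rot charge) -(sum3_rot (fun x y z => charge z x y)).
have : \sum_x \sum_y \sum_z charge x y z <= (6 * t - 2) * \sum_x \sum_y (t < cd x y : nat).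
  by rewrite -sum2Z; apply: leq_sum2 => x y; apply: pair_charge_le.
have -> : 6 * t - 2 = 2 * (3 * t - 1) by lia.
by rewrite -mulnA; set r := \sum_x \sum_y \sum_z (regular x y z : nat); lia.
Qed.

Definition edges6 := \sum_x \sum_y cd x y.
Definition neq_t := \sum_x \sum_y (cd x y != t : nat).
Definition sum_unsat := \sum_x \sum_y \sum_z (unsat x y z : nat).
Definition sum_apex := \sum_z \sum_x \sum_y (apex z x y : nat).
Definition sum_exc := \sum_z \sum_x \sum_y (exc z x y : nat).

Lemma sum_nb x y : \sum_z (h x y z : nat) = cd x y.
Proof. by rewrite -card_set_sum. Qed.

Lemma edges6E : \sum_x \sum_y \sum_z (h x y z : nat) = edges6.
Proof. by apply: eq_bigr => x _; apply: eq_bigr => y _; apply: sum_nb. Qed.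

(** Pairs of codegree at least [D] number at most [edges6 / D], so a large [D] makes apex triples a
    small fraction of all hyperedges. *)
Lemma sum_apex_le : D * sum_apex <= 14 * t * edges6.
Proof.
have le1 : sum_apex <= 14 * t * \sum_z \sum_x (D <= cd z x : nat).
  rewrite /sum_apex big_distrr /=; apply: leq_sum => z _.
  by rewrite sum2_card -card_set_sum; apply: apex_pairs_le.
have le2 : D * (\sum_z \sum_x (D <= cd z x : nat)) <= edges6.
  by rewrite -sum2Z; apply: leq_sum2 => z x; case: (leqP D (cd z x)) => [le|_]; rewrite ?muln1 ?muln0.
by apply: leq_trans (leq_mul (leqnn D) le1) _; rewrite mulnCA leq_mul2l le2 orbT.
Qed.

Lemma sum_exc_le : sum_exc <= 4 * few_bound t D * #|V|.
Proof.
have tD' : 5 * t < D by lia.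
rewrite mulnC /sum_exc -sum_nat_const; apply: leq_sum => c _.
have l1 := ltnW (few_two_private free tD' t_gt1 c).
have l2 := ltnW (few_private_common free tD' t_gt1 c).
rewrite card_set_sum -(pair_big predT predT (fun x y => two_private h t D c (x, y) : nat)) /= in l1.
rewrite card_set_sum -(pair_big predT predT (fun x y => private_common h t D c (x, y) : nat)) /= in l2.
apply: leq_trans (_ : \sum_x \sum_y ((two_private h t D c (x, y) : nat)
   + (two_private h t D c (y, x) : nat) + (private_common h t D c (x, y) : nat)
   + (private_common h t D c (y, x) : nat)) <= _).
  apply: leq_sum2 => x y; rewrite /exc.
  by do 2!case: (two_private _ _ _ _ _); do 2!case: (private_common _ _ _ _ _).
rewrite !sum2D.
rewrite [X in _ + X + _ + _]exchange_big [X in _ + _ + _ + X]exchange_big /=.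
by rewrite -[X in _ <= 4 * X]/(few_bound t D); lia.
Qed.

Lemma sum_unsat_le : sum_unsat <=
  (3 * t - 1) * \sum_x \sum_y (t < cd x y : nat) + 3 * (sum_apex + sum_exc).
Proof.
have rots (F : V -> V -> V -> bool) : \sum_x \sum_y \sum_z ((F x y z : nat) +
    (F y z x : nat) + (F z x y : nat)) = 3 * \sum_x \sum_y \sum_z (F x y z : nat).
  rewrite !sum3D (sum3_rot (fun x y z => F x y z : nat)).
  by rewrite -(sum3_rot (fun x y z => F z x y : nat)); lia.
apply: leq_trans (_ : _ <= \sum_x \sum_y \sum_z ((regular x y z : nat) +
  ((apex x y z : nat) + (apex y z x : nat) + (apex z x y : nat)) +
  ((exc x y z : nat) + (exc y z x : nat) + (exc z x y : nat)))) _.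
  apply: leq_sum3 => x y z; rewrite /regular; case: (unsat x y z) => //=.
  by case: (apex x y z); case: (apex y z x); case: (apex z x y); case: (exc x y z);
    case: (exc y z x); case: (exc z x y).
rewrite sum3D (sum3D (fun x y z => regular x y z : nat)) !rots -/sum_apex -/sum_exc.
by have := sum_regular_le; lia.
Qed.

Definition two_low x y z := [&& h x y z, cd x y <= t & cd x z <= t].
Definition sum_two_low := \sum_x \sum_y \sum_z (two_low x y z : nat).

(** A hyperedge with several pairs of codegree at most [t] is counted through each of them; this
    surplus pays for [sum_two_low]. *)
Lemma edges6_two_low_le : edges6 + sum_two_low <=
  3 * \sum_x \sum_y (cd x y <= t) * cd x y + sum_unsat.
Proof.
have e : \sum_x \sum_y \sum_z (cd x y <= t) * h x y z = \sum_x \sum_y (cd x y <= t) * cd x y.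
  apply: eq_bigr => x _; apply: eq_bigr => y _.
  by rewrite -big_distrr /= sum_nb.
rewrite -edges6E -sum3D -e.
apply: leq_trans (_ : _ <= \sum_x \sum_y \sum_z ((cd x y <= t) * h x y z +
  (cd y z <= t) * h y z x + (cd z x <= t) * h z x y + unsat x y z)) _.
  apply: leq_sum3 => x y z; rewrite /two_low /unsat -(h_rot h x y z) (h_rot h z x y) (cdC _ z x).
  case: (h x y z) => //=; rewrite !muln1.
  by case: (leqP (cd x y)); case: (leqP (cd y z)); case: (leqP (cd x z)).
rewrite !sum3D (sum3_rot (fun x y z => (cd x y <= t) * h x y z)).
rewrite -(sum3_rot (fun x y z => (cd z x <= t) * h z x y)) -/sum_unsat; lia.
Qed.

(** Pair by pair the upper bound is at most [3t], and a codegree other than [t] falls short of this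
    by at least 1. *)
Lemma neq_t_le c : 3 * t * (#|V| * #|V|) <= edges6 + c ->
  neq_t + sum_two_low <= c + 3 * (sum_apex + sum_exc).
Proof.
move=> le6; have := edges6_two_low_le; have := sum_unsat_le.
have : neq_t + 3 * (\sum_x \sum_y (cd x y <= t) * cd x y) +
    (3 * t - 1) * (\sum_x \sum_y (t < cd x y : nat)) <= 3 * t * (#|V| * #|V|).
  rewrite /neq_t -!sum2Z -!sum2D -sum2_const; apply: leq_sum2 => x y.
  by case: (ltngtP (cd x y) t); lia.
lia.
Qed.

Definition nice x y := (cd x y == t) &&
  [forall z, h x y z ==> heavyp h t x z && heavyp h t y z].
Definition sum_nonnice := \sum_x \sum_y (~~ nice x y : nat).

(** If a side [xz] at a pair of codegree [t] is not heavy, either its codegree is at most [t] and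
    the triple is [two_low], or [xz] is counted by [neq_t], with fewer than [5t + 4] choices for
    [y]. *)
Lemma sum_nonnice_le : sum_nonnice <= (10 * t + 9) * neq_t + 2 * sum_two_low.
Proof.
clear free tD t_gt1; pose B x y z := [&& h x y z, cd x y == t & ~~ heavyp h t x z].
have le1 : sum_nonnice <= neq_t + 2 * \sum_x \sum_y \sum_z (B x y z : nat).
  have -> : 2 * (\sum_x \sum_y \sum_z (B x y z : nat)) =
      \sum_x \sum_y \sum_z ((B x y z : nat) + (B y x z : nat)).
    by rewrite sum3D (sum3_swap12 (fun x y z => B x y z : nat)); lia.
  rewrite -sum2D; apply: leq_sum2 => x y; rewrite /nice.
  case: (boolP (cd x y == t)) => // e /=.
  case: (boolP [forall _, _]) => // /forallPn[z]; rewrite negb_imply => /andP[hz nh].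
  rewrite (bigD1 z) //= /B -(hC h x y) -(cdC h x y) hz e /=.
  by move: nh; rewrite negb_and => /orP[] ->; rewrite ?addn1 ?addnS ?addSn.
have le2 : \sum_x \sum_y \sum_z (B x y z : nat) <= sum_two_low + (5 * t + 4) * neq_t.
  apply: leq_trans (_ : _ <= \sum_x \sum_y \sum_z ((two_low x y z : nat) +
    ((t < cd x z < 5 * t + 4) * h x z y))) _.
    apply: leq_sum3 => x y z; rewrite /B /two_low (hA h x z y).
    case: (h x y z) => //=; case: eqP => //= e; rewrite /heavyp -ltnNge e leqnn /=.
    by case: (leqP (cd x z) t) => //= _; case: (ltnP (cd x z) (5 * t + 4)).
  rewrite sum3D leq_add2l (sum3_swap23 (fun x y z => (t < cd x y < 5 * t + 4) * h x y z)).
  rewrite /neq_t -sum2Z; apply: leq_sum2 => x y; rewrite -big_distrr /= sum_nb.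
  by case: (ltngtP (cd x y) t) => //=; case: ltnP; lia.
lia.
Qed.

End Discharge.

(** [D] is chosen so that apex triples use at most half of the allowance [n^2 / K], and [C] so that
    the terms linear in [n] use at most the other half. The upper bound on [edges6] is what controls
    the apex triples. *)
Theorem few_nonnice_pairs t c K : 1 < t -> exists n0, forall (V : finType) (h : threegraph V),
  fan_free h t -> n0 <= #|V| -> 3 * t * (#|V| * #|V|) <= edges6 h + c * #|V| ->
  edges6 h <= 3 * t * (#|V| * #|V|) -> K * sum_nonnice h t <= #|V| * #|V|.
Proof.
move=> t1; set L := 3 * K * (10 * t + 9); set D := 5 * t + 4 + 2 * L * (42 * (t * t)).
set C := 2 * (K * (10 * t + 9) * c + L * (4 * few_bound t D)).
exists C => V h free; set n := #|V| => leC lo up.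
have tD : 5 * t + 4 <= D by rewrite /D leq_addr.
have ha := sum_apex_le free tD; have he := sum_exc_le free tD t1; rewrite -/n in he.
have hq := neq_t_le tD t1 lo; have hs := sum_nonnice_le h t.
set a := sum_apex h t D in ha hq; set e := sum_exc h t D in he hq.
have a2 : 2 * L * a <= n * n.
  have t0 : 0 < 42 * (t * t) by lia.
  rewrite -(leq_pmul2l t0) mulnA [42 * (t * t) * _]mulnC.
  apply: leq_trans (_ : D * a <= _); first by rewrite leq_mul2r /D leq_addl orbT.
  apply: leq_trans ha _; apply: leq_trans (leq_mul (leqnn (14 * t)) up) _.
  by rewrite !mulnA [14 * t * 3]mulnAC.
have s1 : sum_nonnice h t <= (10 * t + 9) * (c * n + 3 * (a + e)).
  apply: leq_trans hs _; apply: leq_trans (leq_mul (leqnn (10 * t + 9)) hq).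
  by rewrite mulnDr leq_add2l leq_mul2r; apply/orP; right; lia.
have e2 : 2 * (K * (10 * t + 9) * c * n + L * e) <= n * n.
  have Le : L * e <= L * (4 * few_bound t D) * n by rewrite -mulnA leq_mul2l he orbT.
  have := leq_mul leC (leqnn n); rewrite /C -mulnA mulnDl.
  by apply: leq_trans; rewrite leq_mul2l /= leq_add2l.
have s2 : 2 * (K * sum_nonnice h t) <= 2 * (K * (10 * t + 9) * c * n + L * e) + 2 * L * a.
  rewrite -(mulnA 2 L a) -mulnDr leq_mul2l /=; apply: leq_trans (leq_mul (leqnn K) s1) _.
  by rewrite /L; lia.
by lia.
Qed.

(** * The common apex set *)

Lemma many_disjoint_pairs (V : finType) (A : {set V * V}) (Q : {set V}) j :
  (forall p, p \in A -> p.1 != p.2) -> 2 * (2 * j + #|Q|) * #|V| < #|A| ->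
  exists s : seq (V * V), [/\ size s = j,
    forall p, p \in s -> [&& p \in A, p.1 \notin Q & p.2 \notin Q]
    & uniq (flatten (map vs2 s))].
Proof.
move=> Aneq cA; pose P (p : V * V) := [&& p \in A, p.1 \notin Q & p.2 \notin Q].
have := @disjoint_or_cover V _ vs2 P 2 j; case.
- by case=> a b /and3P[/Aneq /= ab _ _]; rewrite inE ab.
- by case.
- by case=> s [sz Ps us]; exists s; split=> // p /(allP Ps).
case=> X [cX hX]; exfalso; move: cA; rewrite ltnNge; case/negP.
pose Z := X :|: Q.
apply: leq_trans (_ : #|setX Z setT :|: setX setT Z| <= _).
  apply: subset_leq_card; apply/subsetP=> -[a b] pA; rewrite !inE !andbT /=.
  case aQ : (a \in Q); rewrite ?orbT //; case bQ : (b \in Q); rewrite ?orbT //.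
  have := hX (a, b); rewrite /P pA /= aQ bQ => /(_ isT).
  by rewrite !orbF.
apply: leq_trans (leq_card_setU _ _).1 _; rewrite !cardsX cardsT.
have cZ : #|Z| <= 2 * j + #|Q|.
  by apply: leq_trans (leq_card_setU _ _).1 _; rewrite leq_add2r.
by have := leq_mul cZ (leqnn #|V|); lia.
Qed.

Lemma pigeonhole_in (T V : finType) (B : {set V}) (X : {set T}) (r : V -> T -> bool) m :
  (forall y, y \in B -> exists2 z, z \in X & r y z) -> #|X| * m < #|B| ->
  exists2 z, z \in X & m < #|[set y in B | r y z]|.
Proof.
move=> hB lt; apply/exists_inP; apply: contraLR lt => /exists_inPn le.
rewrite -leqNgt; apply: leq_trans (_ : #|\bigcup_(z in X) [set y in B | r y z]| <= _).
  apply: subset_leq_card; apply/subsetP=> y yB; have [z zX ryz] := hB _ yB.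
  by apply/bigcupP; exists z; rewrite // inE yB.
by apply: card_bigcup_leq => z /le; rewrite -leqNgt.
Qed.

Section Structure.
Variables (V : finType) (h : threegraph V) (t : nat).
Hypothesis free : fan_free h t.
Hypothesis t_gt1 : 1 < t.
Local Notation nb := (nbhd h).
Local Notation cd := (codeg h).
Local Notation n := #|V|.
Local Notation nice := (nice h t).
Local Notation heavy := (heavyp h t).
Local Notation Nh := (Nh h t).
Local Notation nu := (sum_nonnice h t).
Local Notation is_cover := (is_cover h t).

Lemma nice_cd x y : nice x y -> #|nb x y| = t.
Proof. by case/andP=> /eqP. Qed.

Lemma nice_heavy x y z : nice x y -> h x y z -> heavy x z && heavy y z.
Proof. by case/andP=> _ /forallP/(_ z)/implyP. Qed.

Lemma nice_neq x y : nice x y -> x != y.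
Proof.
move=> nxy; have /card_gt0P[z] : 0 < #|nb x y| by rewrite nice_cd //; lia.
by rewrite inE; apply: hneq.
Qed.

(** As [t > 1], the pair has two apexes [z], [w]. In one loose triangle at [x], [w] expands the
    spoke [xy], while the heavy pairs [xz] and [yz] are expanded off [X]; so [X] contains [z] or
    [w]. *)
Lemma cover_nice x X y : is_cover x X -> nice x y -> y \notin X ->
  exists2 z, z \in X & h x y z.
Proof.
move=> [cX hX] nxy yX; have := nice_cd nxy.
have /card_gt1P[z [w [+ + zw]]] : 1 < #|nb x y| by rewrite nice_cd.
rewrite !inE => xyz xyw _; have /andP[xz yz] := nice_heavy nxy xyz.
have [p [xzp pX pl]] := heavy_ext cX xz (isT : size [:: y; w] <= 3).
have [q [yzq qX ql]] := heavy_ext cX yz (isT : size [:: x; w; p] <= 3).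
have := hX (y, z, w, p, q); rewrite /= xyw xzp yzq => /(_ isT).
have [nxy' nxz nyz] := h_distinct xyz; have [_ nxw nyw] := h_distinct xyw.
have [_ nxp nzp] := h_distinct xzp; have [_ nyq nzq] := h_distinct yzq.
move: pl ql; rewrite !inE !negb_or => /andP[py pw] /and3P[qx qw qp].
rewrite nxy' nxz nxw nxp nyz nyw nyq zw nzp nzq [x == q]eq_sym [y == p]eq_sym.
rewrite [w == p]eq_sym [w == q]eq_sym [p == q]eq_sym qx py pw qw qp => /(_ isT).
rewrite (negbTE yX) (negbTE pX) (negbTE qX) /= orbF => /orP[zX|wX].
  by exists z.
by exists w.
Qed.

Definition pairs_in (R : {set V}) := [set p : V * V | [&& p.1 \in R, p.2 \in R & nice p.1 p.2]].

Lemma card_pairs_in (R : {set V}) : #|R| * #|R| <= #|pairs_in R| + nu.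
Proof.
rewrite -cardsX; have -> : nu = #|[set p : V * V | ~~ nice p.1 p.2]|.
  by rewrite /sum_nonnice sum2_card.
apply: leq_trans (leq_card_setU _ _).1; apply: subset_leq_card.
by apply/subsetP=> -[x y]; rewrite !inE /= => /andP[-> ->] /=; case: (nice x y).
Qed.

(** The power counts the possible neighbourhoods inside [z |: X]; the other factor is what
    [many_disjoint_pairs] needs for [t] pairs avoiding two vertices. *)
Definition class_bound := 2 ^ (5 * t + 1) * (2 * (2 * t + 2) * n).

(** By [cover_heavy] the neighbourhoods lie in [z |: X], so a single [W] serves a class containing
    [t] disjoint pairs. If [z] were not in [W], these would give a fan at [z]; if a nice pair had an
    apex [w0] off [W], it would do so with [t - 1] pairs using [W :\ z]. *)
Lemma common_apex_set z X (Y : {set V}) : is_cover z X -> Y \subset Nh z :\: X ->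
  nu + class_bound < #|Y| * #|Y| ->
  exists S : {set V}, [/\ #|S| = t, z \in S &
    forall x y, x \in Nh z :\: X -> y \in Nh z :\: X -> nice x y -> nb x y = S].
Proof.
move=> coX sYR big; set R := Nh z :\: X in sYR *; pose A := pairs_in R.
have cX := coX.1.
have nbX p : p \in A -> nb p.1 p.2 \subset z |: X.
  case: p => x y; rewrite !inE /= => /and3P[/andP[xX xz] /andP[yX yz] nxy].
  apply/subsetP=> w; rewrite !inE => xyw; case: eqVneq => //= wz.
  by have := cover_heavy coX xz yz xyw wz; rewrite (negbTE xX) (negbTE yX).
have cA : class_bound < #|A|.
  have := card_pairs_in Y; have : #|pairs_in Y| <= #|A|; last by lia.
  apply: subset_leq_card; apply/subsetP=> p; rewrite [p \in pairs_in Y]inE [p \in A]inE.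
  case/and3P=> p1 p2 ->.
  by rewrite !(subsetP sYR).
have [||W _] := @pigeonhole_in _ _ A (powerset (z |: X))
    (fun p W => nb p.1 p.2 == W) (2 * (2 * t + 2) * n).
- by move=> p /nbX pX; exists (nb p.1 p.2); rewrite ?inE.
- apply: leq_ltn_trans cA; rewrite /class_bound leq_mul2r card_powerset; apply/orP; right.
  rewrite leq_exp2l // cardsU1; case: (_ \notin _) => /=; lia.
set AW := [set p in A | _] => cAW.
have AWneq p : p \in AW -> p.1 != p.2.
  by rewrite !inE => /andP[/and3P[_ _ /nice_neq]].
have AWP a b : (a, b) \in AW ->
    [/\ nb a b = W, heavy z a && heavy z b & (a \notin X) && (b \notin X)].
  rewrite !inE /= => /andP[/and3P[/andP[aX za] /andP[bX zb] _] /eqP ->].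
  by rewrite za zb aX bX.
have [cW WX] : #|W| = t /\ W \subset z |: X.
  have /card_gt0P[p] : 0 < #|AW| by lia.
  rewrite inE => /andP[pA /eqP <-]; split; last exact: nbX.
  by apply: nice_cd; move: pA; rewrite inE => /and3P[].
have take_pairs j (Q : {set V}) : j <= t -> #|Q| <= 2 -> exists s : seq (V * V), [/\ size s = j,
    forall p, p \in s -> [&& p \in AW, p.1 \notin Q & p.2 \notin Q]
    & uniq (flatten (map vs2 s))].
  move=> jt cQ; apply: many_disjoint_pairs => //; apply: leq_ltn_trans cAW.
  by rewrite leq_mul2r leq_mul2l /= leq_add ?orbT // leq_mul2l jt.
have zW : z \in W.
  apply/negPn/negP=> zW; have [||s [sz sP us]] := @take_pairs t set0; rewrite ?cards0 //.
  have [|s' [fs us' As']] := @greedy_sdr V _ (fun=> W) set0 s.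
    by apply/allP=> p _; rewrite setD0 cW sz.
  apply: (@no_fan_of_apexes _ _ _ free z X s'); rewrite ?fs //.
    by rewrite -sz -fs size_map.
  move=> a b w ps; have : (a, b) \in s by rewrite -fs; apply: (map_f fst ps).
  case/sP/and3P=> /AWP[e /andP[-> ->] /andP[-> ->]] _ _.
  have := allP As' _ ps; rewrite setD0 /= => wW.
  have wz : w != z by apply: contraNneq zW => <-.
  have := subsetP WX _ wW; rewrite !inE (negbTE wz) /= => ->.
  by rewrite -in_nb e wW.
exists W; split=> // x y xR yR nxy; apply/eqP/negPn/negP=> neW.
have xyA : (x, y) \in A by rewrite inE /= xR yR.
have [w0 w0xy w0W] : exists2 w0, w0 \in nb x y & w0 \notin W.
  by apply/subsetPn; apply: contra neW => sub; rewrite eqEcard sub cW nice_cd /=.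
have [||s [sz sP us]] := @take_pairs t.-1 [set x; y]; rewrite ?leq_pred //.
  by rewrite cards2; case: (_ != _).
have [|s' [fs us' As']] := @greedy_sdr V _ (fun=> W :\ z) set0 s.
  apply/allP=> p _; rewrite setD0 sz -ltnS prednK; last by lia.
  by rewrite -cW (cardsD1 z W) zW.
have w0z : w0 != z by apply: contraNneq w0W => ->.
have w0X : w0 \in X.
  by have := subsetP (nbX _ xyA) _ w0xy; rewrite !inE (negbTE w0z).
apply: (@no_fan_of_apexes _ _ _ free z X ((x, y, w0) :: s')).
- have st : size s' = t.-1 by rewrite -sz -fs size_map.
  by rewrite /= st prednK ?(ltnW t_gt1).
- rewrite /= fs us andbT !inE negb_or (nice_neq nxy) /=.
  apply/andP; split; apply/flatten_mapP=> -[[a b] /sP /and3P[_]];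
    by rewrite !inE !negb_or /= => /andP[ax ay] /andP[bx by_] /orP[] /eqP e;
       rewrite e eqxx in ax ay bx by_.
- rewrite /= us' andbT; apply/mapP=> -[p ps e].
  have := allP As' _ ps; rewrite setD0 inE -e => /andP[_ w0W'].
  by rewrite w0W' in w0W.
move=> a b w; rewrite inE => /predU1P[[-> -> ->]|ps].
  move: xR yR; rewrite !inE => /andP[-> ->] /andP[-> ->].
  by rewrite -in_nb w0xy w0X w0z.
have : (a, b) \in s by rewrite -fs; apply: (map_f fst ps).
case/sP/and3P=> /AWP[e /andP[-> ->] /andP[-> ->]] _ _.
have := allP As' _ ps; rewrite setD0 !inE /= => /andP[wz wW].
have := subsetP WX _ wW; rewrite !inE (negbTE wz) /= => ->.
by rewrite -in_nb e wW.
Qed.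

Definition tau p := #|[set y | ~~ nice p y]|.

Lemma sum_tau : \sum_p tau p = nu.
Proof. by apply: eq_bigr => p _; rewrite /tau card_set_sum. Qed.

Lemma popular_apex p X (B : {set V}) m : is_cover p X -> 5 * t * m + tau p + 5 * t < #|B| ->
  exists2 z, z \in X & m < #|[set y in B | nice p y && h p y z]|.
Proof.
move=> coX lt; have cX := coX.1.
pose B' := [set y in B | nice p y] :\: X.
have cB' : 5 * t * m < #|B'|.
  have sub : B \subset B' :|: ([set y | ~~ nice p y] :|: X).
    apply/subsetP=> y yB; rewrite !inE yB /=.
    by case: (nice p y); case: (y \in X); rewrite ?orbT.
  have := subset_leq_card sub.
  have := (leq_card_setU B' ([set y | ~~ nice p y] :|: X)).1.
  have := (leq_card_setU [set y | ~~ nice p y] X).1; rewrite -/(tau p).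
  move: lt; lia.
have [||z zX cz] := @pigeonhole_in _ _ B' X (fun y z => h p y z) m.
- by move=> y; rewrite !inE => /and3P[yX _ py]; apply: cover_nice.
- by apply: leq_ltn_trans cB'; rewrite leq_mul2r cX orbT.
exists z => //; apply: leq_trans cz _; apply: subset_leq_card; apply/subsetP=> y.
by rewrite !inE => /andP[/and3P[_ -> ->] ->].
Qed.

Definition typical p := 40 * t * tau p <= n.

Lemma card_atypical : #|[set p | ~~ typical p]| * n <= 40 * t * nu.
Proof.
rewrite -sum_tau big_distrr /= -sum_nat_const big_mkcond /=; apply: leq_sum => p _.
by rewrite inE /typical -ltnNge; case: ltnP => // /ltnW.
Qed.

(** A popular apex [z1] of one typical vertex yields [S]. Any other typical [p] off the covers has a
    popular apex [z] among the same vertices [L]; a nice pair seen by both [z1] and [z] identifies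
    their apex sets, which makes [p] heavy towards all of [S]. *)
Lemma apex_set_exists :
  (forall m, n <= 100 * (t * t) * m -> nu + class_bound < (m - 5 * t) * (m - 5 * t)) ->
  40 * t * nu < n * n -> 1000 * (t * t) <= n ->
  exists S : {set V}, #|S| = t /\
    \sum_x \sum_y (~~ (S \subset nb x y) : nat) <= nu + 2 * (40 * t * nu + 5 * t * t * n).
Proof.
move=> big nusmall nbig.
have [xc xcP] := fin_all_exists (loose_triangle_cover free).
have bigD (Y : {set V}) z : n <= 100 * (t * t) * #|Y| ->
    nu + class_bound < #|Y :\: xc z| * #|Y :\: xc z|.
  move=> /big lt; apply: leq_trans lt _; apply: leq_mul;
    by have := cardsID (xc z) Y; have := subset_leq_card (subsetIr Y (xc z));
       have := (xcP z).1; lia.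
have tt : 2 * t <= t * t by rewrite leq_mul2r t_gt1 orbT.
have [x0 typ0] : exists x, typical x.
  apply/existsP; apply: contraLR nusmall => /existsPn natyp; rewrite -leqNgt.
  apply: leq_trans card_atypical; rewrite leq_mul2r; apply/orP; right.
  by rewrite -cardsT; apply: subset_leq_card; apply/subsetP=> x _; rewrite inE natyp.
pose m1 := n %/ (10 * t).
have m1lo : m1 * (10 * t) <= n by exact: leq_divM.
have m1hi : n < m1.+1 * (10 * t) by apply: ltn_ceil; lia.
have [|z1 _ cY1] := @popular_apex x0 (xc x0) setT m1 (xcP x0).
  by rewrite cardsT; move: typ0; rewrite /typical; nia.
set Y1 := [set y in _ | _] in cY1; pose L := Y1 :\: xc z1.
have Y1big : n <= 10 * t * #|Y1| by nia.
have sLR : L \subset Nh z1 :\: xc z1.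
  apply: setSD; apply/subsetP=> y; rewrite !inE /= => /andP[n0y h0y].
  by have /andP[_] := nice_heavy n0y h0y; rewrite heavyC.
have [|S [cS z1S RS]] := common_apex_set (xcP z1) sLR.
  by apply: bigD; nia.
have cL : #|Y1| <= #|L| + 5 * t.
  have := cardsID (xc z1) Y1; have := subset_leq_card (subsetIr Y1 (xc z1)).
  by have := (xcP z1).1; rewrite -/L; lia.
(* Up to constants, [5t * m2] is at most [n / (20t)] and [tau p] at most [n / (40t)], together below
   the [n / (10t)] vertices of [Y1]. *)
pose m2 := n %/ (100 * (t * t)).
have m2lo : m2 * (100 * (t * t)) <= n by exact: leq_divM.
have m2hi : n < m2.+1 * (100 * (t * t)) by apply: ltn_ceil; lia.
pose A2 := [set p | typical p && (p \notin \bigcup_(s in S) xc s)].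
have A2P p s : p \in A2 -> s \in S -> p \in Nh s :\: xc s.
  rewrite inE => /andP[typ pxc] sS.
  have pxs s' : s' \in S -> p \notin xc s'.
    by move=> s'S; apply: contra pxc => ps'; apply/bigcupP; exists s'.
  have [|z _ cYp] := @popular_apex p (xc p) L m2 (xcP p).
    have t20 : 0 < 20 * t by lia.
    rewrite -(ltn_pmul2l t20); move: typ; rewrite /typical; nia.
  set Yp := [set y in L | _] in cYp.
  have Ypbig : n <= 100 * (t * t) * #|Yp| by nia.
  have sYz : Yp :\: xc z \subset Nh z :\: xc z.
    apply: setSD; apply/subsetP=> y; rewrite !inE /= => /and3P[_ npy hpy].
    by have /andP[_] := nice_heavy npy hpy; rewrite heavyC.
  have [|Sz [cSz zSz RSz]] := common_apex_set (xcP z) sYz; first exact: bigD.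
  (* Both [RS] and [RSz] determine the neighbourhood of this pair, whence [Sz = S]. *)
  have /card_gt0P[[y y']] : 0 < #|pairs_in (Yp :\: xc z)|.
    by have := card_pairs_in (Yp :\: xc z); have := bigD Yp z Ypbig; lia.
  rewrite inE /= => /and3P[yY y'Y nyy'].
  have inL w : w \in Yp :\: xc z -> w \in L by rewrite !inE => /and3P[_ ->].
  have eS : Sz = S.
    rewrite -(RSz y y') ?(subsetP sYz) //.
    by rewrite (RS y y') // (subsetP sLR) ?inL.
  have zS : z \in S by rewrite -eS.
  have [npy hpy] : nice p y /\ h p y z by move: yY; rewrite !inE => /and4P[].
  have /andP[pz _] := nice_heavy npy hpy.
  have pR : p \in Nh z :\: xc z by rewrite !inE heavyC pz pxs.
  have := RSz p y pR (subsetP sYz _ yY) npy; rewrite eS => enb.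
  rewrite !inE pxs //= heavyC.
  by have := sS; rewrite -enb inE => /(nice_heavy npy)/andP[].
exists S; split=> //.
have cA2 : #|~: A2| * n <= 40 * t * nu + 5 * t * t * n.
  apply: leq_trans (leq_add card_atypical (leqnn _)); rewrite -mulnDl leq_mul2r.
  apply/orP; right; apply: leq_trans (_ : #|[set p | ~~ typical p] :|: \bigcup_(s in S) xc s| <= _).
    apply: subset_leq_card; apply/subsetP=> p; rewrite !inE negb_and negbK.
    by case: (typical p).
  apply: leq_trans (leq_card_setU _ _).1 _; rewrite leq_add2l.
  apply: leq_trans (card_bigcup_leq (m := 5 * t) _) _; first by move=> s _; exact: (xcP s).1.
  by rewrite cS mulnC.
apply: leq_trans (_ : _ <= \sum_x \sum_y ((~~ nice x y : nat) +
    ((x \notin A2 : nat) + (y \notin A2 : nat)))) _.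
  apply: leq_sum2 => x y; case: (boolP (nice x y)) => [nxy|_]; last by case: (_ \subset _).
  case: (boolP (x \in A2)) => [xA|_]; last by case: (_ \subset _).
  case: (boolP (y \in A2)) => [yA|_]; last by case: (_ \subset _).
  by rewrite (RS x y) ?A2P // subxx.
rewrite sum2D leq_add2l sum2D [X in _ + X <= _]exchange_big /=.
have e : \sum_(x : V) \sum_(y : V) (x \notin A2 : nat) = #|~: A2| * n.
  rewrite (eq_bigr (fun x => (x \notin A2 : nat) * n)); last first.
    by move=> x _; rewrite sum_nat_const mulnC cardT -cardE.
  by rewrite -big_distrl /= -card_set_sum; congr (_ * _); apply: eq_card => x; rewrite !inE.
by rewrite e addnn -mul2n leq_mul2l cA2.
Qed.

End Structure.

Theorem dominant_set t K : 1 < t -> exists K1 n0, forall (V : finType) (h : threegraph V),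
  fan_free h t -> n0 <= #|V| -> K1 * sum_nonnice h t <= #|V| * #|V| ->
  exists S : {set V}, #|S| = t /\
    K * (\sum_x \sum_y (~~ (S \subset nbhd h x y) : nat)) <= #|V| * #|V|.
Proof.
move=> t1; pose q := 100 * (t * t); pose C := 2 ^ (5 * t + 1) * (2 * (2 * t + 2)).
pose K1 := 8 * (q * q) + 2 * K * (1 + 80 * t) + 80 * t.
pose n0 := 20 * t * q + 8 * (q * q) * C + 1000 * (t * t) + 40 * K * (t * t) + 1.
exists K1, n0 => V h free; set n := #|V|; set nu := sum_nonnice h t => nbig nuK.
have q0 : 0 < q by rewrite /q; lia.
have nu1 : 8 * (q * q) * nu <= n * n.
  by apply: leq_trans nuK; rewrite leq_mul2r; apply/orP; right; rewrite /K1; lia.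
have nu2 : (2 * K * (1 + 80 * t) + 80 * t) * nu <= n * n.
  by apply: leq_trans nuK; rewrite leq_mul2r; apply/orP; right; rewrite /K1; lia.
have [n1 n2 n3 n4] : [/\ 20 * t * q <= n, 8 * (q * q) * C < n, 1000 * (t * t) <= n
    & 40 * K * (t * t) <= n].
  by move: nbig; rewrite /n0; move: (8 * (q * q) * C) (20 * t * q) => u v; split; lia.
have [|||S [cS le]] := @apex_set_exists V h t free t1.
- move=> m; rewrite -/q -/n -/nu => nm; rewrite /class_bound [2 ^ _ * _]mulnA -/C -/n.
  have m20 : 20 * t <= m.
    by rewrite -(leq_pmul2l q0) mulnC; apply: leq_trans n1 nm.
  set r := m - 5 * t; have nr : n <= q * (2 * r).
    by apply: leq_trans nm _; rewrite leq_mul2l /r; apply/orP; right; lia.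
  have nn : n * n <= q * q * (4 * (r * r)).
    by have := leq_mul nr nr; congr (_ <= _); lia.
  have qq0 : 0 < q * q by rewrite muln_gt0 q0.
  have a1 : 2 * nu <= r * r.
    rewrite -(leq_pmul2l qq0); move: nu1 nn; clear; nia.
  have a2 : 2 * (C * n) < r * r.
    have n_gt0 : 0 < n by apply: leq_ltn_trans n2.
    rewrite -(ltn_pmul2l qq0); have := n2; rewrite -(ltn_pmul2r n_gt0); move: nn; clear; nia.
  by move: a1 a2; clear; lia.
- by rewrite -/nu -/n; have : 0 < n * n; [rewrite muln_gt0; lia | move: nu2; clear; nia].
- by [].
exists S; split=> //; apply: leq_trans (leq_mul (leqnn K) le) _; rewrite -/nu -/n.
have : 40 * K * (t * t) * n <= n * n by rewrite leq_mul2r n4 orbT.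
by move: nu2; clear; nia.
Qed.

(** * Hyperedges avoiding the apex set *)

Lemma pair_up (V : eqType) j (r : seq V) : size r = 2 * j ->
  exists l : seq (V * V), size l = j /\ flatten [seq [:: p.1; p.2] | p <- l] = r.
Proof.
elim: j r => [|j IH] [|a [|b r]]; rewrite ?mulnS //=; first by exists [::].
by case=> /IH [l [<- <-]]; exists ((a, b) :: l).
Qed.

Lemma leq_card_setD (V : finType) (A X : {set V}) : #|A| <= #|A :\: X| + #|X|.
Proof. by rewrite -(cardsID X A) addnC leq_add2l subset_leq_card // subsetIr. Qed.

Section Exact.
Variables (V : finType) (h : threegraph V) (t : nat).
Hypothesis free : fan_free h t.
Hypothesis t_gt1 : 1 < t.
Variable S : {set V}.
Hypothesis cS : #|S| = t.
Local Notation nb := (nbhd h).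
Local Notation cd := (codeg h).
Local Notation n := #|V|.
Local Notation heavy := (heavyp h t).
Local Notation Nh := (Nh h t).

Definition good x y := S \subset nb x y.
Definition nongood := \sum_x \sum_y (~~ good x y : nat).

Lemma good_edge x y s : good x y -> s \in S -> h x y s.
Proof. by move=> /subsetP g /g; rewrite inE. Qed.

Lemma good_notin x y : good x y -> (x \notin S) && (y \notin S).
Proof.
move=> g; apply/andP; split; apply/negP=> /(good_edge g) /h_distinct[_].
  by rewrite eqxx.
by rewrite eqxx.
Qed.

Lemma good_neq x y : good x y -> x != y.
Proof.
move=> g; have /card_gt0P[s sS] : 0 < #|S| by rewrite cS; lia.
exact: hneq (good_edge g sS).
Qed.

Variable k : nat.
Hypothesis nongood_small : 2 * (k * k) * nongood <= n * n.
Hypothesis n_gt0 : 0 < n.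

(** Otherwise at least [(n / k)^2] pairs fail to be good, twice what [nongood_small] admits. *)
Lemma good_pair_avoiding (A A' : {set V}) (R : V -> {set V}) r :
  (forall y, y \in A -> #|R y| <= r) -> n <= k * #|A| -> n <= k * (#|A'| - r) ->
  exists y y', [/\ y \in A, y' \in A', y' \notin R y & good y y'].
Proof.
move=> cR nA nA'.
case: (boolP [exists p : V * V, [&& p.1 \in A, p.2 \in A', p.2 \notin R p.1 & good p.1 p.2]]).
  by case/existsP=> -[y y'] /and4P[/= yA yA' yR g]; exists y, y'.
move=> /existsPn nex; exfalso.
have le : #|A| * (#|A'| - r) <= nongood.
  rewrite -sum_nat_const /nongood big_mkcond /=; apply: leq_sum => y _.
  case: ifP => // yA; rewrite -card_set_sum.
  apply: leq_trans (_ : #|A' :\: R y| <= _).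
    by have := leq_card_setD A' (R y); have := cR _ yA; lia.
  apply: subset_leq_card; apply/subsetP=> y'; rewrite !inE => /andP[yR yA'].
  by have := nex (y, y'); rewrite /= yA yA' yR.
have := leq_mul nA nA'; have n2 : 0 < n * n by rewrite muln_gt0 n_gt0.
have := leq_mul (leqnn (2 * (k * k))) le; move: nongood_small n2; clear.
by move: (#|A'| - r) #|A| nongood (n * n) => a b c d; nia.
Qed.

Lemma good_pairs_in (A Q : {set V}) j : n <= k * (#|A| - (2 * j + #|Q|)) ->
  exists s : seq (V * V), [/\ size s = j, uniq (flatten (map vs2 s)) &
    forall p, p \in s -> [&& p.1 \in A, p.2 \in A, p.1 \notin Q, p.2 \notin Q & good p.1 p.2]].
Proof.
move=> nA.
pose P (p : V * V) := [&& p.1 \in A, p.2 \in A, p.1 \notin Q, p.2 \notin Q & good p.1 p.2].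
have := @disjoint_or_cover V _ vs2 P 2 j; case.
- by case=> a b /and5P[_ _ _ _ /good_neq /= ab]; rewrite inE ab.
- by case.
- by case=> s [sz Ps us]; exists s; split=> // p /(allP Ps).
case=> X [cX hX]; exfalso; pose A' := A :\: (X :|: Q).
have cA' : #|A| - (2 * j + #|Q|) <= #|A'|.
  by have := leq_card_setD A (X :|: Q); have := (leq_card_setU X Q).1; rewrite -/A'; lia.
have nA' : n <= k * #|A'| by apply: leq_trans nA _; rewrite leq_mul2l cA' orbT.
have [||y [y' [yA yA' _ g]]] := @good_pair_avoiding A' A' (fun=> set0) 0 _ nA'.
- by move=> *; rewrite cards0.
- by rewrite subn0.
move: yA yA'; rewrite !inE !negb_or => /andP[/andP[yX yQ] yA] /andP[/andP[yX' yQ'] yA'].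
have := hX (y, y'); rewrite /P /= yA yA' yQ yQ' g => /(_ isT).
by rewrite (negbTE yX) (negbTE yX').
Qed.

(** Otherwise [Nh v] contains [t] disjoint good pairs, which the elements of [S] expand to a fan at
    [v]. *)
Lemma heavy_degree_small v : v \notin S -> k * (#|Nh v| - 2 * t) < n.
Proof.
move=> vS; rewrite ltnNge; apply/negP=> le.
have [|s [sz us sP]] := @good_pairs_in (Nh v) set0 t; first by rewrite cards0 addn0.
have [|s' [fs us' As']] := @greedy_sdr V _ (fun=> S) set0 s.
  by apply/allP=> p _; rewrite setD0 cS sz.
apply: (@no_fan_of_apexes _ _ _ free v S s'); rewrite ?fs //.
  by rewrite -sz -fs size_map.
move=> a b w ps; have : (a, b) \in s by rewrite -fs; apply: (map_f fst ps).
case/sP/and5P; rewrite !inE /= => -> -> _ _ g; have /andP[-> ->] := good_notin g.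
have := allP As' _ ps; rewrite setD0 /= => wS; rewrite wS (good_edge g wS) /=.
by apply: contraNneq vS => <-.
Qed.

(** [abz] and [t - 1] good pairs expanded by [S :\ s] would be the outer edges of a fan at [s]. This
    is what puts two vertices of a hyperedge avoiding [S] into [weak s]. *)
Lemma at_most_one_heavy s a b z : n <= k * (#|Nh s| - (2 * t + 3)) -> s \in S ->
  h a b z -> a \notin S -> b \notin S -> z \notin S -> heavy s a -> heavy s b -> False.
Proof.
move=> le sS abz aS bS zS sa sb.
have [ab az bz] := h_distinct abz.
have [|r [sz us sP]] := @good_pairs_in (Nh s) [set a; b; z] t.-1.
  apply: leq_trans le _; rewrite leq_mul2l; apply/orP; right.
  have : #|[set a; b; z]| <= 3.
    by rewrite setUC cardsU1 cards2; case: (_ \notin _); case: (_ != _).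
  by lia.
have [|s' [fs us' As']] := @greedy_sdr V _ (fun=> S :\ s) set0 r.
  apply/allP=> p _; rewrite setD0 sz -ltnS prednK ?(ltnW t_gt1) //.
  by rewrite -cS (cardsD1 s S) sS.
(* [z] is an apex outside [S], so the separating set has to be enlarged by it. *)
apply: (@no_fan_of_apexes _ _ _ free s (z |: S) ((a, b, z) :: s')).
- have st : size s' = t.-1 by rewrite -sz -fs size_map.
  by rewrite /= st prednK ?(ltnW t_gt1).
- rewrite /= fs us andbT !inE negb_or ab /=.
  apply/andP; split; apply/flatten_mapP=> -[[c d] /sP /and5P[_ _]];
    rewrite !inE !negb_or /= -!andbA => /and3P[c1 c2 _] /and3P[d1 d2 _] _ /orP[] /eqP e;
    by rewrite e eqxx in c1 c2 d1 d2.
- rewrite /= us' andbT; apply/mapP=> -[p ps e].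
  have := allP As' _ ps; rewrite setD0 inE -e => /andP[_ zS'].
  by rewrite zS' in zS.
move=> c d w; rewrite inE => /predU1P[[-> -> ->]|ps].
  rewrite abz sa sb !inE !negb_or eqxx az bz aS bS /=.
  by apply: contraNneq zS => ->.
have : (c, d) \in r by rewrite -fs; apply: (map_f fst ps).
case/sP/and5P; rewrite !inE /= !negb_or => -> -> /andP[_ cz] /andP[_ dz] g.
have /andP[cS' dS'] := good_notin g; rewrite cz dz cS' dS' /=.
have := allP As' _ ps; rewrite setD0 !inE /= => /andP[ws wS].
by rewrite wS ws orbT (good_edge g wS).
Qed.

Lemma no_good_fan u (s : seq (V * V * V * V)) : u \notin S -> size s = t ->
  uniq (flatten (map vs4 s)) ->
  (forall a b x y, (a, b, x, y) \in s ->
    [&& good a b, h u a x, h u b y, x \notin S & y \notin S]) -> False.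
Proof.
move=> uS sz us sP.
have outS v : v \in u :: flatten (map vs4 s) -> v \notin S.
  rewrite inE => /predU1P[->//|/flatten_mapP[[[[a b] x] y] /sP /and5P[g _ _ xS yS]]].
  by have /andP[aS bS] := good_notin g; rewrite !inE => /or4P[] /eqP ->.
apply: (@no_fan_of_open_triangles _ _ _ free u s sz).
  rewrite /= us andbT; apply/flatten_mapP=> -[[[[a b] x] y] /sP /and5P[_ uax uby _ _]].
  have [ua ux _] := h_distinct uax; have [ub uy _] := h_distinct uby.
  by rewrite !inE (negbTE ua) (negbTE ux) (negbTE ub) (negbTE uy).
apply/allP=> -[[[a b] x] y] /sP /and5P[g -> -> _ _] /=.
rewrite -{1}cS; apply: subset_leq_card; apply/subsetP=> v vS.
rewrite in_setD inE; apply/andP; split; last by rewrite inE; exact: good_edge g vS.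
by apply: contraTN vS => /outS.
Qed.

(** The listed vertices will expand the spokes; the ends of each triangle are chosen afterwards as a
    good pair in the two neighbourhoods at [u]. *)
Lemma good_pairs_along u (Q : {set V}) (l : seq (V * V)) : size l <= t ->
  (forall p, p \in l -> n <= k * (cd u p.1 - (#|Q| + 2 * t)) /\
                        n <= k * (cd u p.2 - (#|Q| + 2 * t))) ->
  exists s : seq (V * V * (V * V)), [/\ map fst s = l,
    uniq (flatten (map vs2 (map snd s))) &
    forall p y, (p, y) \in s -> [&& h u p.1 y.1, h u p.2 y.2, good y.1 y.2,
      y.1 \notin Q & y.2 \notin Q]].
Proof.
elim: l => [|p l IH] /= st lP; first by exists [::].
have [|q ql|s [fs us sP]] := IH; [exact: ltnW| by apply: lP; rewrite inE ql orbT |].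
pose X := Q :|: [set v in flatten (map vs2 (map snd s))].
have cX : #|X| <= #|Q| + 2 * t.
  apply: leq_trans (leq_card_setU _ _).1 _; rewrite leq_add2l.
  apply: leq_trans (card_set_seq _) _; rewrite (@size_flatten_const _ _ _ 2); last by case.
  by rewrite size_map -(size_map fst) fs leq_mul2l ltnW.
have [n1 n2] := lP p (mem_head _ _).
have bd v : n <= k * (cd u v - (#|Q| + 2 * t)) -> n <= k * #|nb u v :\: X|.
  move=> le; apply: leq_trans le _; rewrite leq_mul2l /codeg; apply/orP; right.
  by have := leq_card_setD (nb u v) X; lia.
have [||y [y' [yA yA' _ g]]] :=
    @good_pair_avoiding (nb u p.1 :\: X) (nb u p.2 :\: X) (fun=> set0) 0 _ (bd _ n1).
- by move=> *; rewrite cards0.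
- by rewrite subn0 bd.
move: yA yA'; rewrite 2!in_setD !in_setU !negb_or !in_nb ![_ \in [set _ in _]]inE.
case/andP=> /andP[yQ ys] hy /andP[/andP[yQ' ys'] hy'].
exists ((p, (y, y')) :: s); split=> /=.
- by rewrite fs.
- by rewrite us andbT inE negb_or (good_neq g) ys ys'.
- move=> q z; rewrite inE => /predU1P[[-> ->]|]; last exact: sP.
  by rewrite /= hy hy' g yQ yQ'.
Qed.

(** From [2t] such partners, paired up, [good_pairs_along] builds [t] triangles at [u]. The [4t]
    allows for the [2t] partners and the at most [2t] ends already chosen. *)
Lemma few_linear_partners u (B : {set V}) : u \notin S -> [disjoint B & S] ->
  (forall v, v \in B -> n <= k * (cd u v - 4 * t)) -> #|B| < 2 * t.
Proof.
move=> uS dBS Bbig; rewrite ltnNge; apply/negP=> cB.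
pose r := take (2 * t) (enum B).
have szr : size r = 2 * t by rewrite size_takel // -cardE.
have ur : uniq r by rewrite take_uniq // enum_uniq.
have rB v : v \in r -> v \in B by move/mem_take; rewrite mem_enum.
have [l [szl fl]] := pair_up szr.
have lr p : p \in l -> (p.1 \in r) && (p.2 \in r).
  by move=> pl; rewrite -fl; apply/andP; split; apply/flatten_mapP; exists p;
    rewrite ?inE ?eqxx ?orbT.
pose Q := [set v in r].
have cQ : #|Q| + 2 * t <= 4 * t by have := card_set_seq r; rewrite szr -/Q; lia.
have bd v : v \in r -> n <= k * (cd u v - (#|Q| + 2 * t)).
  move=> /rB /Bbig le; apply: leq_trans le _; rewrite leq_mul2l; apply/orP; right.
  by lia.
have [||s [fs us sP]] := @good_pairs_along u Q l.
- by rewrite szl.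
- by move=> p /lr /andP[p1 p2]; split; apply: bd.
pose g (q : V * V * (V * V)) := (q.2.1, q.2.2, q.1.1, q.1.2).
apply: (@no_good_fan u (map g s) uS).
- by rewrite size_map -szl -fs size_map.
- have pe : perm_eq (flatten (map vs4 (map g s))) (flatten (map vs2 (map snd s)) ++ r).
    rewrite -fl -fs -!map_comp; apply: perm_trans (perm_flatten_cat _ _ _).
    by apply: perm_flatten_map => -[[a b] [c d]].
  rewrite (perm_uniq pe) cat_uniq us ur andbT /=; apply/hasPn=> v vr /=.
  apply/negP=> /flatten_mapP[_ /mapP[[p y] ps ->] vy].
  have /and5P[_ _ _ y1 y2] := sP _ _ ps; move: vy y1 y2; case: (y) => a b /=.
  by rewrite !inE => /orP[] /eqP <-; rewrite vr.
move=> a b x y /mapP[[p [c d]] ps [-> -> -> ->]].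
rewrite (hA h u c) (hA h u d); have /and5P[/= -> -> -> _ _] := sP _ _ ps.
have pl : p \in l by rewrite -fs; apply: (map_f fst ps).
have notS v : v \in r -> v \notin S by move/rB => vB; rewrite (disjointFr dBS vB).
by have /andP[p1 p2] := lr _ pl; rewrite !notS.
Qed.

(** Two reached vertices forming a good pair span an open triangle at [u], expanded by their
    partners [g y], [g y'] in [B]. If no [t] of these are disjoint, [4t] vertices [X] meet them all.
    Dropping [X], the at most [4tl] vertices reached through it, and [2l + 1] partners per vertex
    still leaves a good pair whose triangle misses [X]. *)
Lemma few_vertices_along u (B : {set V}) l : u \notin S -> [disjoint B & S] ->
  (forall v, v \in B -> cd u v <= l) ->
  k * (#|[set y | [exists v in B, h u v y]]| - (4 * t + 1 + (4 * t + 2) * l)) < n.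
Proof.
move=> uS dBS Bl; set A := [set y | _]; rewrite ltnNge; apply/negP=> le.
pose g y := odflt u [pick v in B | h u v y].
have gP y : y \in A -> (g y \in B) && h u (g y) y.
  rewrite inE => /existsP[v /andP[vB uvy]]; rewrite /g; case: pickP => //= /(_ v).
  by rewrite vB uvy.
pose P (T : V * V * V * V) := let: (a, b, x, y) := T in
  [&& good a b, h u a x, h u b y, x \in B & y \in B] && uniq (vs4 T).
have := @disjoint_or_cover V _ vs4 P 4 t; case.
- by case=> [[[a b] x] y] /andP[].
- by case=> [[[a b] x] y].
- case=> s [sz Ps us]; apply: (@no_good_fan u s uS sz us) => a b x y /(allP Ps).
  case/andP=> /and5P[-> -> -> xB yB] _.
  by rewrite (disjointFr dBS xB) (disjointFr dBS yB).
case=> X [cX hX].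
pose W := \bigcup_(x in X :&: B) nb u x.
have cW : #|W| <= 4 * t * l.
  apply: leq_trans (card_bigcup_leq (m := l) _) _.
    by move=> x; rewrite inE => /andP[_ /Bl].
  by rewrite leq_mul2r (leq_trans (subset_leq_card (subsetIl X B)) cX) orbT.
pose A' := A :\: (X :|: W).
(* Avoiding [R y] keeps [y'] apart from [g y], [g y'] from [g y], and [y] from [g y']. *)
pose R y := g y |: (nb u (g y) :|: (if y \in B then nb u y else set0)).
have cR y : y \in A' -> #|R y| <= 2 * l + 1.
  rewrite inE => /andP[_ yA]; have /andP[gB _] := gP _ yA.
  have c1 : #|nb u (g y)| <= l := Bl _ gB.
  have c2 : #|if y \in B then nb u y else set0| <= l.
    by case: ifP => [/Bl|]; rewrite ?cards0.
  have := (leq_card_setU (nb u (g y)) (if y \in B then nb u y else set0)).1.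
  by rewrite /R cardsU1; case: (_ \notin _); move: c1 c2 => /=; lia.
have cA' : #|A| <= #|A'| + (4 * t + 4 * t * l).
  by have := leq_card_setD A (X :|: W); have := (leq_card_setU X W).1; rewrite -/A'; lia.
have nA' : n <= k * (#|A'| - (2 * l + 1)).
  by apply: leq_trans le _; rewrite leq_mul2l; apply/orP; right; lia.
have nA'' : n <= k * #|A'|.
  by apply: leq_trans nA' _; rewrite leq_mul2l leq_subr orbT.
have [y [y' [yA' yA'' yR gd]]] := good_pair_avoiding cR nA'' nA'.
case/setDP: yA' => yA; rewrite in_setU => /norP[yX yW].
case/setDP: yA'' => yA'; rewrite in_setU => /norP[yX' yW'].
have /andP[gB ugy] := gP _ yA; have /andP[gB' ugy'] := gP _ yA'.
have nX v w : v \notin W -> w \in B -> h u w v -> w \notin X.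
  move=> vW wB uwv; apply: contra vW => wX; apply/bigcupP; exists w; rewrite inE ?wX //.
have := hX (y, y', g y, g y'); rewrite /P gd gB gB' (hA h u y) (hA h u y') ugy ugy' /=.
rewrite (negbTE yX) (negbTE yX') (negbTE (nX _ _ yW gB ugy)) (negbTE (nX _ _ yW' gB' ugy')) /=.
have [_ _ gyy] := h_distinct ugy; have [_ _ gyy'] := h_distinct ugy'.
rewrite !inE !negb_or (good_neq gd) [y == g y]eq_sym gyy [y' == g y']eq_sym gyy' /=.
move: yR; rewrite /R !in_setU !negb_or in_set1 => /and3P[-> n2 n3] /=.
rewrite in_nb in n2; rewrite andbT => H; suff /H : (y != g y') && (g y != g y') by [].
apply/andP; split.
  by apply: contra n3 => /eqP e; rewrite e gB' in_nb.
by apply: contra n2 => /eqP ->.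
Qed.

Definition weak s := [set u | (u \notin S) && ~~ heavy s u].

(** A good pair [u y] gives the hyperedge [s u y], so a weak [u] has fewer than [5t + 4] good
    partners. *)
Lemma card_weak s : s \in S -> #|weak s| * (n - (5 * t + 4)) <= nongood.
Proof.
move=> sS; rewrite -sum_nat_const /nongood big_mkcond /=; apply: leq_sum => u _.
case: ifP => //; rewrite inE => /andP[_]; rewrite /heavyp -ltnNge => lt.
rewrite -card_set_sum.
have : #|~: [set y | ~~ good u y]| <= cd s u.
  apply: subset_leq_card; apply/subsetP=> y; rewrite !inE negbK => g.
  by rewrite h_rot; exact: good_edge g sS.
move=> le; rewrite leq_subLR -(cardsC [set y | ~~ good u y]) addnC leq_add2r.
exact: leq_trans le (ltnW lt).
Qed.

Lemma card_Nh_weak s : n <= #|Nh s| + (t + #|weak s|).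
Proof.
have sub : [set: V] \subset Nh s :|: (S :|: weak s).
  by apply/subsetP=> v _; rewrite !inE; case: (heavy s v); case: (v \in S).
rewrite -cardsT; apply: leq_trans (subset_leq_card sub) _.
apply: leq_trans (leq_card_setU _ _).1 _; rewrite leq_add2l -cS.
exact: (leq_card_setU _ _).1.
Qed.

Lemma sum_over_le (B : {set V}) (F : V -> nat) c :
  (forall u, u \in B -> F u <= c) -> (forall u, u \notin B -> F u = 0) -> \sum_u F u <= #|B| * c.
Proof.
move=> Fc F0; rewrite -sum_nat_const [X in _ <= X]big_mkcond /=; apply: leq_sum => u _.
by case: ifP => [/Fc|/negbT/F0 ->].
Qed.

Definition high (B : {set V}) l u := [set v in B | l < cd u v].
Definition reach (B : {set V}) l u :=
  [set y | [exists v in [set v in B | cd u v <= l], h u v y]].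

(** Partners [v] of high codegree give the main term [(2t - 1) n]. For a low partner, [y] is reached
    from [u] and from [v]: a light pair among the three is paid for by [f2] or [f3], and if all are
    heavy the triple is an apex triple at [u]. *)
Lemma edges_on_pairs_of (B : {set V}) l a hb :
  (forall u, u \in B -> #|high B l u| < 2 * t) ->
  (forall u, u \in B -> #|reach B l u| <= a) ->
  (forall u, u \in B -> #|Nh u| <= hb) ->
  \sum_u \sum_v \sum_y ([&& u \in B, v \in B & h u v y] : nat) <=
  #|B| * ((2 * t - 1) * n + (5 * t + 4) * #|B| + 2 * ((5 * t + 4) * a) + 14 * t * hb).
Proof.
move=> Bhigh Breach Bheavy.
pose f1 u v y := [&& u \in B, v \in high B l u & h u v y].
pose f2 u v y := [&& u \in B, (v \in B) && ~~ heavy u v & h u v y].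
pose f3 u v y := [&& u \in B, (y \in reach B l u) && ~~ heavy u y & h u v y].
pose f4 u v y := (u \in B) && [&& 5 * t + 4 <= cd u v, 5 * t + 4 <= cd u y, h v y u & t < cd v y].
apply: leq_trans (_ : \sum_u \sum_v \sum_y ((f1 u v y : nat) + (f2 u v y : nat)
    + (f3 u v y + f3 v u y) + (f4 u v y : nat)) <= _).
  apply: leq_sum3 => u v y; rewrite /f1 /f2 /f3 /f4 -(hC h u v y) -(h_rot h u v y).
  case: (boolP (u \in B)) => // uB; case: (boolP (v \in B)) => // vB.
  case: (boolP (h u v y)) => // uvy; rewrite !inE ?uB ?vB ?andbT /=.
  case: (ltnP l (cd u v)) => //= low.
  have uy : [exists w in [set w in B | cd u w <= l], h u w y].
    by apply/existsP; exists v; rewrite inE vB low.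
  have vy : [exists w in [set w in B | cd v w <= l], h v w y].
    by apply/existsP; exists u; rewrite inE uB cdC low hC.
  rewrite uy vy /= /heavyp.
  case: (leqP (5 * t + 4) (cd u v)) => //= _; case: (leqP (5 * t + 4) (cd u y)) => //= _.
  by case: (leqP (5 * t + 4) (cd v y)) => //= hvy; have -> : t < cd v y by lia.
rewrite !sum3D (sum3_swap12 (fun u v y => f3 u v y : nat)).
have s1 : \sum_u \sum_v \sum_y (f1 u v y : nat) <= #|B| * ((2 * t - 1) * n).
  apply: sum_over_le => u uB.
    apply: leq_trans (_ : #|high B l u| * n <= _).
      apply: sum_over_le => v vh; first by rewrite -card_set_sum; exact: max_card.
      by rewrite big1 // => y _; rewrite /f1 (negbTE vh) andbF.
    by rewrite leq_mul2r; apply/orP; right; move: (Bhigh _ uB); clear; lia.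
  by rewrite big1 // => v _; rewrite big1 // => y _; rewrite /f1 (negbTE uB).
have s2 : \sum_u \sum_v \sum_y (f2 u v y : nat) <= #|B| * ((5 * t + 4) * #|B|).
  apply: sum_over_le => u uB; last first.
    by rewrite big1 // => v _; rewrite big1 // => y _; rewrite /f2 (negbTE uB).
  rewrite [X in _ <= X]mulnC; apply: sum_over_le => v vB; last first.
    by rewrite big1 // => y _; rewrite /f2 (negbTE vB) andbF.
  case: (boolP (heavy u v)) => [hv|]; first by rewrite big1 // => y _; rewrite /f2 hv !andbF.
  rewrite /heavyp -ltnNge => /ltnW; apply: leq_trans; rewrite -card_set_sum.
  by apply: subset_leq_card; apply/subsetP=> y; rewrite !inE => /and3P[].
have s3 : \sum_u \sum_v \sum_y (f3 u v y : nat) <= #|B| * ((5 * t + 4) * a).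
  apply: sum_over_le => u uB; last first.
    by rewrite big1 // => v _; rewrite big1 // => y _; rewrite /f3 (negbTE uB).
  rewrite exchange_big /= [X in _ <= X]mulnC.
  apply: leq_trans (_ : #|reach B l u| * (5 * t + 4) <= _); last first.
    by rewrite leq_mul2r Breach ?orbT.
  apply: sum_over_le => y yr; last first.
    by rewrite big1 // => v _; rewrite /f3 (negbTE yr) andbF.
  case: (boolP (heavy u y)) => [hv|]; first by rewrite big1 // => v _; rewrite /f3 hv !andbF.
  rewrite /heavyp -ltnNge => /ltnW; apply: leq_trans; rewrite -card_set_sum.
  by apply: subset_leq_card; apply/subsetP=> v; rewrite !inE => /and3P[_ _]; rewrite hA.
have s4 : \sum_u \sum_v \sum_y (f4 u v y : nat) <= #|B| * (14 * t * hb).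
  apply: sum_over_le => u uB; last first.
    by rewrite big1 // => v _; rewrite big1 // => y _; rewrite /f4 (negbTE uB).
  rewrite sum2_card; apply: leq_trans (_ : 14 * t * #|Nh u| <= _); last first.
    by rewrite leq_mul2l Bheavy ?orbT.
  apply: leq_trans (apex_pairs_le free (leqnn _) u).
  by apply: subset_leq_card; apply/subsetP=> p; rewrite !inE => /andP[].
by apply: leq_trans (leq_add (leq_add (leq_add s1 s2) (leq_add s3 s3)) s4) _; lia.
Qed.

Definition outside x y z := [&& h x y z, x \notin S, y \notin S & z \notin S].
Definition missing x y z := [&& ~~ h x y z, x != y, y != z, x != z
  & [|| x \in S, y \in S | z \in S]].

(** Each counted triple has one vertex [s] in [S] and exactly one vertex in [weak s], so no triple
    is counted twice and each contributes all six orders. *)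
Lemma missing_ge : 6 * (\sum_(s in S) #|weak s| * (n - (6 * t + 4 + #|weak s|))) <=
  \sum_x \sum_y \sum_z (missing x y z : nat).
Proof.
pose rho s u y := [&& s \in S, u \in weak s, y \notin S, y \notin weak s & ~~ h s u y].
have le : \sum_(s in S) #|weak s| * (n - (6 * t + 4 + #|weak s|)) <=
    \sum_s \sum_u \sum_y (rho s u y : nat).
  rewrite big_mkcond /=; apply: leq_sum => s _; case: ifP => // sS.
  rewrite -sum_nat_const big_mkcond /=; apply: leq_sum => u _; case: ifP => // uU.
  rewrite -card_set_sum.
  have sub : [set: V] \subset [set y | rho s u y] :|: (S :|: (weak s :|: nb s u)).
    apply/subsetP=> y _; rewrite !in_setU [y \in [set _ | _]]inE /rho sS uU in_nb /=.
    by case: (y \in S); case: (y \in weak s); case: (h s u y).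
  have lt : #|nb s u| < 5 * t + 4.
    by move: uU; rewrite inE => /andP[_]; rewrite /heavyp -ltnNge.
  have cU : #|S :|: (weak s :|: nb s u)| <= t + (#|weak s| + (5 * t + 4)).
    apply: leq_trans (leq_card_setU _ _).1 _; rewrite cS leq_add2l.
    by apply: leq_trans (leq_card_setU _ _).1 _; rewrite leq_add2l ltnW.
  rewrite leq_subLR -cardsT; apply: leq_trans (subset_leq_card sub) _.
  apply: leq_trans (leq_card_setU _ _).1 _; rewrite addnC leq_add2r.
  by apply: leq_trans cU _; lia.
apply: leq_trans (leq_mul (leqnn 6) le) _.
have -> : 6 * (\sum_s \sum_u \sum_y (rho s u y : nat)) =
  \sum_x \sum_y \sum_z ((rho x y z : nat) + rho x z y + (rho y x z + rho y z x)
    + (rho z x y + rho z y x)).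
  rewrite !sum3D (sum3_swap23 (fun x y z => rho x y z : nat)).
  rewrite (sum3_swap12 (fun x y z => rho x y z : nat)).
  rewrite (sum3_rot (fun x y z => rho x y z : nat)).
  rewrite -(sum3_rot (fun x y z => rho z x y : nat)).
  rewrite (sum3_swap12 (fun x y z => rho z x y : nat)).
  by rewrite -(sum3_rot (fun x y z => rho z x y : nat)); lia.
apply: leq_sum3 => x y z.
have key a b c : a \in S -> b \notin S -> c \notin S ->
    (rho a b c : nat) + rho a c b <= [&& ~~ h a b c, a != b, b != c & a != c].
  move=> aS bS cS'; rewrite /rho aS bS cS' (hA h a c b) /=.
  have -> : a != b by apply: contraNneq bS => <-.
  have -> : a != c by apply: contraNneq cS' => <-.
  case: (eqVneq b c) => [->|_]; first by case: (c \in weak a).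
  by case: (b \in weak a); case: (c \in weak a); case: (h a b c).
have e a b c : rho a b c = rho a b c && [&& a \in S, b \notin S & c \notin S].
  rewrite /rho [b \in weak a]inE.
  by case: (a \in S); case: (b \in S); case: (c \in S); rewrite /= ?andbF ?andbT.
rewrite (e x y z) (e x z y) (e y x z) (e y z x) (e z x y) (e z y x) /missing.
case: (boolP (x \in S)) => xS; case: (boolP (y \in S)) => yS; case: (boolP (z \in S)) => zS;
  rewrite /= ?andbF ?andbT ?add0n ?addn0 //.
- exact: key.
- apply: leq_trans (key y x z yS xS zS) _; rewrite (hC h y) [y == x]eq_sym.
  by case: (h x y z) => //=; rewrite [(y != z) && _]andbC.
- apply: leq_trans (key z x y zS xS yS) _; rewrite (h_rot h z) [z == x]eq_sym [z == y]eq_sym.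
  by case: (h x y z); case: (x == y); case: (y == z); case: (x == z).
Qed.

Lemma outside_le_missing : k = 320 * t * (4 * t + 2) -> 320 * (t * t) * k <= n ->
  \sum_x \sum_y \sum_z (outside x y z : nat) <= \sum_x \sum_y \sum_z (missing x y z : nat).
Proof.
move=> ek nbig; pose k1 := 160 * t * (4 * t + 2).
have kk1 : k = 2 * k1 by rewrite ek /k1 !mulnA.
have k1big : 1600 * t <= k1 by rewrite /k1; nia.
have n1 : 8 * t * k1 <= n by apply: leq_trans nbig; rewrite kk1; nia.
have n2 : 320 * (t * t) * 1600 <= n.
  by apply: leq_trans nbig; rewrite leq_mul2l kk1; apply/orP; right; lia.
have tt : 2 * t <= t * t by rewrite leq_mul2r t_gt1 orbT.
(* [e] will bound weak sets, heavy neighbourhoods off [S] and reached sets. The errors come to at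
   most [(31t + 12) e] plus a constant, below the gap [n] between [(2t - 1) n] and [2t n]. The
   choice of [l] keeps [(4t + 2) l] below [n / (160t)]. *)
pose e := n %/ (40 * t); pose l := n %/ k1.
have t40 : 0 < 40 * t by lia.
have le_e m : 40 * t * m <= n -> m <= e by move=> le; rewrite /e leq_divRL // mulnC.
have e_hi : 40 * t * e <= n by rewrite mulnC; exact: leq_divM.
have l_hi : k1 * l <= n by rewrite mulnC; exact: leq_divM.
have k1_gt0 : 0 < k1 by lia.
have Ule s : s \in S -> #|weak s| <= e.
  move=> sS; apply: le_e; have := card_weak sS; move: nongood_small; rewrite kk1.
  move: #|weak s| nongood k1big n2; clear - t_gt1 => m q k1big n2 le1 le2.
  have mn : m * n <= 2 * q.
    apply: leq_trans (_ : m * (2 * (n - (5 * t + 4))) <= _); last by lia.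
    by rewrite leq_mul2l; apply/orP; right; nia.
  have le3 : 4 * (k1 * k1) * m * n <= n * n by nia.
  rewrite leq_pmul2r in le3; last by nia.
  by apply: leq_trans le3; rewrite leq_mul2r; apply/orP; right; nia.
have hb v : v \notin S -> #|Nh v| <= e.
  move=> vS; apply: le_e; have lt := heavy_degree_small vS; rewrite kk1 in lt.
  have le1 : 80 * t * (#|Nh v| - 2 * t) <= 2 * k1 * (#|Nh v| - 2 * t).
    by rewrite leq_mul2r; apply/orP; right; lia.
  apply: leq_trans (_ : 40 * t * (#|Nh v| - 2 * t + 2 * t) <= _).
    by rewrite leq_mul2l addnC -leq_subLR leqnn orbT.
  by move: lt le1 n2; move: (#|Nh v| - 2 * t) => r; clear; lia.
(* Hyperedges off [S] are counted through one weak set, missing triples through all [t] of them;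
   hence the smallest one is used. *)
have [s0 s0S Umin] : exists2 s0, s0 \in S & forall s, s \in S -> #|weak s0| <= #|weak s|.
  have /card_gt0P[sx sxS] : 0 < #|S| by rewrite cS; lia.
  by case: (arg_minnP (fun s => #|weak s|) sxS) => s0 s0S mn; exists s0.
pose B := weak s0.
have BS : [disjoint B & S].
  by rewrite disjoint_subset; apply/subsetP=> u; rewrite !inE => /andP[].
have uS u : u \in B -> u \notin S by rewrite inE => /andP[].
have Bhigh u : u \in B -> #|high B l u| < 2 * t.
  move=> uB; apply: few_linear_partners (uS _ uB) _ _.
    by apply: disjointWl BS; apply/subsetP=> v; rewrite inE => /andP[].
  move=> v; rewrite inE => /andP[_]; rewrite /l ltn_divLR // kk1 => lt.
  have lt8 : 8 * t < cd u v by rewrite -(ltn_pmul2r k1_gt0); exact: leq_ltn_trans n1 lt.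
  apply: leq_trans (ltnW lt) _; rewrite mulnC [2 * k1]mulnC -mulnA leq_mul2l.
  by apply/orP; right; lia.
have Breach u : u \in B -> #|reach B l u| <= e.
  move=> uB; apply: le_e.
  have lt : k * (#|reach B l u| - (4 * t + 1 + (4 * t + 2) * l)) < n.
    apply: few_vertices_along (uS _ uB) _ _.
      by apply: disjointWl BS; apply/subsetP=> v; rewrite inE => /andP[].
    by move=> v; rewrite inE => /andP[].
  rewrite kk1 in lt.
  set w := (4 * t + 2) * l in lt.
  have lw : 160 * t * w <= n by apply: leq_trans l_hi; rewrite mulnA.
  have le1 : 320 * t * (#|reach B l u| - (4 * t + 1 + w)) <=
      2 * k1 * (#|reach B l u| - (4 * t + 1 + w)).
    by rewrite leq_mul2r; apply/orP; right; lia.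
  apply: leq_trans (_ : 40 * t * (#|reach B l u| - (4 * t + 1 + w) + (4 * t + 1 + w)) <= _).
    by rewrite leq_mul2l addnC -leq_subLR leqnn orbT.
  by move: lt lw le1 n2 tt; move: (#|reach B l u| - (4 * t + 1 + w)) => r; move: (w) => w'; clear; lia.
have := edges_on_pairs_of Bhigh Breach (fun u uB => hb u (uS u uB)).
set Q3 := (X in X <= _) => leQ.
have e80 : 80 * e <= n.
  by apply: leq_trans e_hi; rewrite leq_mul2r; apply/orP; right; lia.
have n3 : n <= k * (#|Nh s0| - (2 * t + 3)).
  apply: leq_trans (_ : 2 * (#|Nh s0| - (2 * t + 3)) <= _); last first.
    by rewrite kk1 leq_mul2r; apply/orP; right; lia.
  have := card_Nh_weak s0; have := Ule _ s0S.
  by move: #|weak s0| #|Nh s0| e80 n2 tt t_gt1 => a b; clear; lia.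
have le1 : \sum_x \sum_y \sum_z (outside x y z : nat) <= 3 * Q3.
  pose q u v y : nat := [&& u \in B, v \in B & h u v y].
  have -> : 3 * Q3 = \sum_x \sum_y \sum_z (q x y z + q y z x + q z x y).
    by rewrite !sum3D (sum3_rot q) -(sum3_rot (fun x y z => q z x y)) -/Q3; lia.
  apply: leq_sum3 => x y z; rewrite /outside /q -(h_rot h x y z) (h_rot h z x y).
  case: (boolP (h x y z)) => // hxyz /=; rewrite !andbT !inE.
  case: (boolP (x \in S)) => // xS; case: (boolP (y \in S)) => // yS.
  case: (boolP (z \in S)) => // zS /=.
  case: (boolP (heavy s0 x)) => hx; case: (boolP (heavy s0 y)) => hy;
    case: (boolP (heavy s0 z)) => hz //=.
  - by case: (at_most_one_heavy n3 s0S hxyz).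
  - by case: (at_most_one_heavy n3 s0S hxyz).
  - by rewrite hA in hxyz; case: (at_most_one_heavy n3 s0S hxyz).
  - by rewrite h_rot in hxyz; case: (at_most_one_heavy n3 s0S hxyz).
apply: leq_trans le1 _; apply: leq_trans missing_ge.
apply: leq_trans (leq_mul (leqnn 3) leQ) _.
apply: leq_trans (_ : 6 * (t * (#|B| * (n - (6 * t + 4 + e)))) <= _); last first.
  rewrite leq_mul2l /= -{1}cS -sum_nat_const; apply: leq_sum => s sS.
  by apply: leq_mul; [exact: Umin | apply: leq_sub2l; rewrite leq_add2l Ule].
have cB : (5 * t + 4) * #|B| <= (5 * t + 4) * e by rewrite leq_mul2l (Ule _ s0S) orbT.
have e2 : 2 * e <= t * e by rewrite leq_mul2r t_gt1 orbT.
have tn : 2 * n <= t * n by rewrite leq_mul2r t_gt1 orbT.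
rewrite mulnCA [t * _]mulnCA [6 * (#|B| * _)]mulnCA leq_mul2l; apply/orP; right.
rewrite mulnBl mul1n mulnBr.
by move: cB e2 tn e_hi n2 tt t_gt1; move: #|B| n (e) => b n e'; clear; lia.
Qed.

End Exact.

(** * Embedding the expanded fan *)

Section OrderedTriples.
Variable T : finType.

Lemma set3_swap12 (x y z : T) : [set x; y; z] = [set y; x; z].
Proof. by rewrite [[set x; y]]setUC. Qed.

Lemma set3_swap23 (x y z : T) : [set x; y; z] = [set x; z; y].
Proof. by rewrite setUAC. Qed.

Lemma cards3 (x y z : T) : (#|[set x; y; z]| == 3) = [&& x != y, x != z & y != z].
Proof.
rewrite setUC cardsU1 cards2 !inE negb_or [z == x]eq_sym [z == y]eq_sym.
by case: (x == y); case: (x == z); case: (y == z).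
Qed.

(** The successive form of the membership turns the count of orderings into [3 * 2 * 1]. *)
Lemma set3_eq (e : {set T}) x y z : #|e| = 3 ->
  ([set x; y; z] == e) = [&& x \in e, y \in e :\ x & z \in e :\ x :\ y].
Proof.
move=> ce; apply/eqP/and3P=> [se|[xe ye ze]].
  have : #|[set x; y; z]| == 3 by rewrite se ce.
  rewrite cards3 => /and3P[n1 n2 n3]; rewrite -se !inE !eqxx.
  by rewrite [y == x]eq_sym [z == x]eq_sym [z == y]eq_sym n1 n2 n3 /= ?orbT.
have /and3P[n1 n2 n3] : [&& x != y, x != z & y != z].
  move: ye ze; rewrite !inE => /andP[yx _] /and3P[zy zx _].
  by rewrite eq_sym yx eq_sym zx eq_sym zy.
apply/eqP; rewrite eqEcard ce; have /eqP -> : #|[set x; y; z]| == 3 by rewrite cards3 n1 n2.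
rewrite andbT; apply/subsetP=> w; rewrite !inE => /orP[/orP[]|] /eqP -> //.
  by move: ye; rewrite inE => /andP[].
by move: ze; rewrite !inE => /and3P[].
Qed.

Lemma ordered_triples_of (e : {set T}) : #|e| = 3 ->
  \sum_x \sum_y \sum_z ([set x; y; z] == e : nat) = 6.
Proof.
move=> ce.
transitivity (\sum_(x in e) \sum_(y in e :\ x) \sum_(z in e :\ x :\ y) 1).
  rewrite [RHS]big_mkcond /=; apply: eq_bigr => x _; case: ifP => xe; last first.
    by rewrite big1 // => y _; rewrite big1 // => z _; rewrite set3_eq // xe.
  rewrite [RHS]big_mkcond /=; apply: eq_bigr => y _; case: ifP => ye; last first.
    by rewrite big1 // => z _; rewrite set3_eq // xe ye.
  by rewrite [RHS]big_mkcond /=; apply: eq_bigr => z _; rewrite set3_eq // xe ye; case: (_ \in _).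
transitivity (\sum_(x in e) 2); last by rewrite sum_nat_const ce.
apply: eq_bigr => x xe; have c2 : #|e :\ x| = 2.
  by have := cardsD1 x e; rewrite xe ce; lia.
rewrite (eq_bigr (fun=> 1)); first by rewrite sum_nat_const c2.
move=> y ye; rewrite sum_nat_const muln1.
by have := cardsD1 y (e :\ x); rewrite ye c2; lia.
Qed.

Lemma ordered_triples (E : {set {set T}}) : (forall e, e \in E -> #|e| = 3) ->
  \sum_x \sum_y \sum_z ([set x; y; z] \in E : nat) = 6 * #|E|.
Proof.
move=> E3; transitivity (\sum_x \sum_y \sum_z \sum_(e in E) ([set x; y; z] == e : nat)).
  apply: eq_bigr => x _; apply: eq_bigr => y _; apply: eq_bigr => z _.
  case: (boolP (_ \in E)) => [sE|sE].
    rewrite (bigD1 [set x; y; z]) //= eqxx big1 // => e /andP[_].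
    by rewrite eq_sym => /negbTE ->.
  by rewrite big1 // => e eE; case: eqP => // se; rewrite se eE in sE.
transitivity (\sum_(e in E) \sum_x \sum_y \sum_z ([set x; y; z] == e : nat)).
  rewrite [RHS]exchange_big /=; apply: eq_bigr => x _.
  rewrite [RHS]exchange_big /=; apply: eq_bigr => y _.
  by rewrite [RHS]exchange_big.
rewrite (eq_bigr (fun=> 6)) ?sum_nat_const; first by rewrite mulnC.
by move=> e /E3 /ordered_triples_of.
Qed.

End OrderedTriples.

Section FanEmbedding.
Variables (t n : nat) (H : {set {set 'I_n}}).

(* [Some (i, inl b)] are the outer vertices of the i-th triangle; [inr (Some b)]
   and [inr None] index the expansion vertices of its spokes and outer edge. *)
Definition fan_vertex := option ('I_t * (bool + option bool)).

(** An explicit index for the edges, [Some b] for a spoke and [None] for the outer edge, in place of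
    the sigma type in [contains_exp3]. *)
Definition fan_edge (q : 'I_t * option bool) : {set option ('I_t * bool)} :=
  if q.2 is Some b then [set None; Some (q.1, b)]
  else [set Some (q.1, false); Some (q.1, true)].

Lemma fan_edge_in q : fan_edge q \in fan t.
Proof.
case: q => i [b|]; rewrite /fan_edge inE; apply/orP; [left|right]; apply/imsetP.
  by exists (i, b).
by exists i.
Qed.

Lemma fan_edgeP e : e \in fan t -> exists q, fan_edge q == e.
Proof.
rewrite inE => /orP[] /imsetP[].
  by case=> i b _ ->; exists (i, Some b).
by move=> i _ ->; exists (i, None).
Qed.

Lemma fan_edge_inj : injective fan_edge.
Proof.
case=> i [b|] [j [c|]] /setP e.
- by have := e (Some (i, b)); rewrite !inE eqxx => /esym /eqP[-> ->].
- by have := e None; rewrite !inE.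
- by have := e None; rewrite !inE.
- by have := e (Some (i, true)); rewrite !inE eqxx orbT => /esym /orP[] /eqP[] // ->.
Qed.

Definition fan_embeds := exists g : fan_vertex -> 'I_n, [/\ injective g,
  forall i b, [set g None; g (Some (i, inl b)); g (Some (i, inr (Some b)))] \in H &
  forall i, [set g (Some (i, inl false)); g (Some (i, inl true)); g (Some (i, inr None))] \in H].

Lemma contains_fanP : reflect fan_embeds (contains_exp3 (fan t) H).
Proof.
apply: (iffP existsP) => [[f /andP[/injectiveP injf /forallP fH]]|[g [injg gs go]]].
  pose edge q : {e | e \in fan t} := exist _ (fan_edge q) (fan_edge_in q).
  pose vert (j : fan_vertex) : option ('I_t * bool) + {e | e \in fan t} :=
    match j with
    | None => inl None
    | Some (i, inl b) => inl (Some (i, b))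
    | Some (i, inr o) => inr (edge (i, o))
    end.
  have injv : injective vert.
    move=> [[i [b|o]]|] [[j [c|o']]|] //=; first by case=> -> ->.
    by case=> /fan_edge_inj[-> ->].
  exists (f \o vert); split=> [|i b|i] /=; first exact: inj_comp.
    have := fH (edge (i, Some b)); rewrite /= /fan_edge /= imsetU1 imset_set1.
    by rewrite setUC.
  have := fH (edge (i, None)); rewrite /= /fan_edge /= imsetU1 imset_set1.
  by rewrite setUC.
pose code (e : {e | e \in fan t}) := [pick q | fan_edge q == val e].
have codeP e : exists2 q, code e = Some q & fan_edge q = val e.
  rewrite /code; case: pickP => [q /eqP qe|]; first by exists q.
  by have [q qe] := fan_edgeP (valP e) => /(_ q); rewrite qe.
pose psi (v : option ('I_t * bool) + {e | e \in fan t}) : fan_vertex :=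
  match v with
  | inl None => None
  | inl (Some (i, b)) => Some (i, inl b)
  | inr e => omap (fun q => (q.1, inr q.2)) (code e)
  end.
have injpsi : injective psi.
  have psiE e : exists2 q, psi (inr e) = Some (q.1, inr q.2) & fan_edge q = val e.
    by have [q eq qe] := codeP e; exists q; rewrite //= eq.
  move=> [[[i b]|]|e] [[[j c]|]|e'] //; try by case: (psiE e) => q ->.
  - by case=> -> ->.
  - by case: (psiE e') => q ->.
  - by case: (psiE e') => q ->.
  - have [q -> qe] := psiE e; have [q' -> qe'] := psiE e'; case=> e1 e2.
    congr inr; apply: val_inj; rewrite -qe -qe'; congr fan_edge.
    by move: e1 e2; case: (q) (q') => [? ?] [? ?] /= -> ->.
exists [ffun v => g (psi v)]; apply/andP; split.
  by apply/injectiveP=> v w; rewrite !ffunE => /injg /injpsi.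
apply/forallP=> e; rewrite ffunE /=; have [[i o] -> qe] := codeP e.
rewrite -qe /fan_edge /=; case: {qe}o => [b|].
  rewrite imsetU1 imset_set1 !ffunE /= setUC; exact: gs.
rewrite imsetU1 imset_set1 !ffunE /= setUC; exact: go.
Qed.

End FanEmbedding.

Lemma nth_flatten_const (T I : Type) (x0 : T) (i0 : I) (f : I -> seq T) k s i j :
  (forall i, size (f i) = k) -> i < size s -> j < k ->
  nth x0 (flatten (map f s)) (k * i + j) = nth x0 (f (nth i0 s i)) j.
Proof.
move=> fk; elim: s i => // u s IH [|i] /= lti ltj; rewrite nth_cat fk.
  by rewrite muln0 ltj.
by rewrite mulnS -addnA ltnNge leq_addr /= addKn IH.
Qed.

Section HypergraphOf.
Variables (t n : nat) (H : {set {set 'I_n}}).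
Hypothesis H3 : uniform3 H.

Lemma H_card e : e \in H -> #|e| = 3.
Proof. by move=> eH; move/forallP/(_ e)/implyP/(_ eH): H3 => /eqP. Qed.

Definition triple_in x y z := [set x; y; z] \in H.

Lemma triple_inC x y z : triple_in x y z = triple_in y x z.
Proof. by rewrite /triple_in set3_swap12. Qed.

Lemma triple_inA x y z : triple_in x y z = triple_in x z y.
Proof. by rewrite /triple_in set3_swap23. Qed.

Lemma triple_in_neq x y z : triple_in x y z -> x != y.
Proof. by move/H_card/eqP; rewrite cards3 => /and3P[]. Qed.

Definition graph_of := ThreeGraph triple_inC triple_inA triple_in_neq.

Lemma edges6_graph_of : edges6 graph_of = 6 * #|H|.
Proof. by rewrite -edges6E; apply: ordered_triples H_card. Qed.

Lemma fan_free_graph_of : ~~ contains_exp3 (fan t) H -> fan_free graph_of t.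
Proof.
move/contains_fanP=> nfan c s sz ls; apply/negP=> us; apply: nfan.
(* [pos] follows the order [a, b, x, y, z] of [lverts]; with it [idx] locates a fan vertex in the
   list [l], and [uniq] becomes injectivity. *)
pose pos (k : bool + option bool) := match k with
  | inl false => 0 | inl true => 1 | inr (Some false) => 2 | inr (Some true) => 3 | inr None => 4 end.
have pos5 k : pos k < 5 by case: k => [[]|[[]|]].
have posI : injective pos by move=> [[]|[[]|]] [[]|[[]|]].
pose T0 := (c, c, c, c, c).
have lv5 (T : 'I_n * 'I_n * 'I_n * 'I_n * 'I_n) : size (lverts T) = 5.
  by case: T => [[[[? ?] ?] ?] ?].
pose idx (j : fan_vertex t) := if j is Some (i, k) then (5 * i + pos k).+1 else 0.
pose l := c :: flatten (map lverts s).
have idx_lt j : idx j < size l.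
  case: j => [[i k]|] //=; rewrite ltnS (size_flatten_const _ lv5) sz.
  by have := pos5 k; have := ltn_ord i; lia.
exists (fun j => nth c l (idx j)).
have gE i k : nth c l (idx (Some (i, k))) = nth c (lverts (nth T0 s i)) (pos k).
  by rewrite /= (nth_flatten_const _ T0) // sz.
split=> [j j' /eqP|i b|i].
- rewrite nth_uniq //; move: j j' => [[i k]|] [[j k']|] //= /eqP[e].
  have ek : pos k = pos k' by have := pos5 k; have := pos5 k'; lia.
  have ei : i = j by apply: val_inj => /=; lia.
  by rewrite ei (posI _ _ ek).
- have : loose graph_of c (nth T0 s i) by apply/(all_nthP _ ls); rewrite sz.
  rewrite !gE; case: (nth T0 s i) => [[[[a b'] x] y] z] /and3P[h1 h2 _].
  by case: b => /=.
- have : loose graph_of c (nth T0 s i) by apply/(all_nthP _ ls); rewrite sz.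
  by rewrite !gE; case: (nth T0 s i) => [[[[a b'] x] y] z] /and3P[].
Qed.

End HypergraphOf.

(** * The extremal hypergraph: all triples meeting a fixed set *)

Section LowerBound.
Variables (t n : nat) (S : {set 'I_n}).

Definition meeting : {set {set 'I_n}} :=
  [set e : {set 'I_n} | (#|e| == 3) && ~~ [disjoint e & S]].

Lemma card_meeting : #|meeting| = 'C(n, 3) - 'C(n - #|S|, 3).
Proof.
pose A := [set e : {set 'I_n} | #|e| == 3].
pose D := [set e : {set 'I_n} | (e \subset ~: S) && (#|e| == 3)].
have cA : #|A| = 'C(n, 3) by rewrite /A card_draws card_ord.
have cD : #|D| = 'C(n - #|S|, 3) by rewrite /D cards_draws cardsCs setCK card_ord.
rewrite -cA -cD; have -> : meeting = A :\: D.
  apply/setP=> e; rewrite !inE -disjoints_subset; case: (#|e| == 3); rewrite ?andbF ?andbT //.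
rewrite cardsD; congr (_ - _); apply: eq_card => e.
by rewrite !inE andbA andbC andbA andbb andbC.
Qed.

Lemma uniform3_meeting : uniform3 meeting.
Proof. by apply/forallP=> e; apply/implyP; rewrite inE => /andP[]. Qed.

(** With the centre in [S], each of the [t] outer edges needs one more vertex of [S], making
    [t + 1]; otherwise each of the [2t] spokes needs its own. *)
Lemma meeting_fan_free : 1 < t -> #|S| = t -> ~~ contains_exp3 (fan t) meeting.
Proof.
move=> t1 cS; apply/contains_fanP=> -[g [injg gs go]].
have hit x y z : [set x; y; z] \in meeting -> [|| x \in S, y \in S | z \in S].
  rewrite inE => /andP[_ /pred0Pn[w /andP[]]]; rewrite !inE.
  by move=> /orP[/orP[]|] /eqP -> /= ->; rewrite ?orbT.
have inj_le (J : finType) (f : J -> fan_vertex t) :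
    injective f -> (forall j, g (f j) \in S) -> #|J| <= t.
  move=> injf fS; rewrite -cS -(card_imset _ (inj_comp injg injf)).
  by apply: subset_leq_card; apply/subsetP=> _ /imsetP[j _ ->]; apply: fS.
case: (boolP (g None \in S)) => cinS.
  pose f (j : option 'I_t) : fan_vertex t := if j is Some i then
    Some (i, if g (Some (i, inl false)) \in S then inl false else
             if g (Some (i, inl true)) \in S then inl true else inr None) else None.
  have : #|{: option 'I_t}| <= t.
    apply: (inj_le _ f) => [[i|] [j|] //= [->] //|[i|] //=].
    by case: ifP => // n1; case: ifP => // n2; have := hit _ _ _ (go i); rewrite n1 n2.
  by rewrite card_option card_ord ltnn.
pose f (j : 'I_t * bool) : fan_vertex t :=
  Some (j.1, if g (Some (j.1, inl j.2)) \in S then inl j.2 else inr (Some j.2)).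
have : #|{: 'I_t * bool}| <= t.
  apply: (inj_le _ f) => [[i b] [j c] /=|[i b] /=].
    by rewrite /f /= => -[-> e]; congr pair; move: e; do 2!case: ifP => _ //; case.
  rewrite /f /=; case: ifP => // n1.
  by have := hit _ _ _ (gs i b); rewrite (negbTE cinS) n1.
by rewrite card_prod card_ord card_bool; lia.
Qed.

End LowerBound.

(** * The exact upper bound *)

Lemma bin3_bounds m j N : m + j <= N ->
  3 * j * (m * m.-1) + 6 * 'C(m, 3) <= 6 * 'C(m + j, 3) <= 6 * 'C(m, 3) + 3 * j * (N * N.-1).
Proof.
have bin2' p : 2 * 'C(p, 2) = p * p.-1.
  by rewrite mulnC -[2]/(2`!) bin_ffact ffactnS ffactn1.
elim: j => [|j IH] le; first by rewrite addn0 muln0 !mul0n addn0 leqnn.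
have /andP[lo hi] := IH (leq_trans (leq_add (leqnn m) (leqnSn j)) le).
rewrite addnS binS mulnDr.
have -> : 6 * 'C(m + j, 2) = 3 * ((m + j) * (m + j).-1) by rewrite -bin2' mulnA.
have l1 : m * m.-1 <= (m + j) * (m + j).-1 by apply: leq_mul; lia.
have l2 : (m + j) * (m + j).-1 <= N * N.-1 by apply: leq_mul; lia.
by apply/andP; split; lia.
Qed.

Lemma disjoint_set3 (T : finType) (x y z : T) (S : {set T}) :
  [disjoint [set x; y; z] & S] = [&& x \notin S, y \notin S & z \notin S].
Proof.
rewrite disjoint_subset; apply/subsetP/and3P => [sub|[xS yS zS] w].
  by split; apply: sub; rewrite !inE eqxx ?orbT.
by rewrite !inE => /orP[/orP[]|] /eqP ->.
Qed.

Theorem fan_upper_bound t : 1 < t -> exists n0, forall n (H : {set {set 'I_n}}), n0 <= n ->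
  uniform3 H -> ~~ contains_exp3 (fan t) H -> #|H| <= 'C(n, 3) - 'C(n - t, 3).
Proof.
move=> t1; pose k := 320 * t * (4 * t + 2).
have [K1 [n1 dom]] := dominant_set (2 * (k * k)) t1.
(* The constant comes from [(n - t)(n - t - 1) >= n^2 - (2t + 1) n]. *)
have [n2 few] := few_nonnice_pairs (3 * t * (2 * t + 1)) K1 t1.
exists (n1 + n2 + 320 * (t * t) * k + t + 1) => n H nbig H3 Hfree; rewrite leqNgt; apply/negP=> gt.
set f := 'C(n, 3) - _ in gt.
(* Keeping just one hyperedge too many provides the upper bound on [edges6] that [few_nonnice_pairs]
   requires. *)
have [H' [sH' cH']] : exists H' : {set {set 'I_n}}, H' \subset H /\ #|H'| = f.+1.
  exists [set e in take f.+1 (enum H)]; split.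
    by apply/subsetP=> e; rewrite inE => /mem_take; rewrite mem_enum.
  rewrite cardsE; have /card_uniqP -> : uniq (take f.+1 (enum H)) by rewrite take_uniq // enum_uniq.
  by rewrite size_takel // -cardE.
have H'3 : uniform3 H'.
  apply/forallP=> e; apply/implyP=> /(subsetP sH') eH.
  by move/forallP/(_ e)/implyP/(_ eH): H3.
have H'free : fan_free (graph_of H'3) t.
  apply: fan_free_graph_of; apply: contra Hfree => /existsP[g /andP[gi /forallP gH]].
  by apply/existsP; exists g; rewrite gi; apply/forallP=> e; apply: (subsetP sH').
set h := graph_of H'3 in H'free.
have cn : #|{: 'I_n}| = n by exact: card_ord.
have tn : t <= n by lia.
have /andP[lo hi] : 3 * t * ((n - t) * (n - t).-1) + 6 * 'C(n - t, 3) <= 6 * 'C(n, 3)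
    <= 6 * 'C(n - t, 3) + 3 * t * (n * n.-1).
  by have := @bin3_bounds (n - t) t n; rewrite subnK //; apply.
have e6 : edges6 h = 6 * f.+1 by rewrite edges6_graph_of cH'.
have [nn1 nn2 nn3] : [/\ n1 <= n, n2 <= n & 320 * (t * t) * k <= n].
  by move: nbig; move: (320 * (t * t) * k) => u; split; lia.
have lo6 : 3 * t * (n * n) <= 6 * f.+1 + 3 * t * (2 * t + 1) * n.
  have : 3 * t * ((n - t) * (n - t).-1) <= 6 * f by rewrite /f; lia.
  have : n = n - t + t by rewrite subnK.
  move: (n - t) (f) (n) => m f' n' ->; set q := m * m.-1.
  have mm : t * (m * m) = t * q + t * m by rewrite /q -mulnDr -mulnSr; case: (m).
  by clearbody q => le; move: mm le; clear; nia.
have hi6 : 6 * f.+1 <= 3 * t * (n * n).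
  have : 6 * f <= 3 * t * (n * n.-1) by rewrite /f mulnBr leq_subLR.
  have : 0 < n by lia.
  by move: (f) (n) => f' [//|p] _ /=; move: t1; clear; nia.
have fnn : K1 * sum_nonnice h t <= n * n.
  by have := few _ h H'free; rewrite cn e6; apply.
have [||S [cS nS]] := dom _ h H'free; rewrite ?cn //.
have n0 : 0 < #|{: 'I_n}| by rewrite cn; lia.
have le : \sum_x \sum_y \sum_z (outside h S x y z : nat) <=
    \sum_x \sum_y \sum_z (missing h S x y z : nat).
  have nn4 : 320 * (t * t) * k <= #|{: 'I_n}| by rewrite cn.
  exact: (outside_le_missing H'free t1 cS nS n0 (erefl k) nn4).
(* Passing from [meeting S] to [H'] removes [M] and adds [B]; [#|B| <= #|M|] then contradicts
   [#|H'| = f.+1]. *)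
pose M := [set e in meeting S | e \notin H'].
pose B := [set e in H' | [disjoint e & S]].
have eB : \sum_x \sum_y \sum_z (outside h S x y z : nat) = 6 * #|B|.
  rewrite -ordered_triples; last by move=> e; rewrite inE => /andP[/(H_card H'3)].
  do 3!apply: eq_bigr => ? _; congr (nat_of_bool _).
  by rewrite inE disjoint_set3.
have eM : \sum_x \sum_y \sum_z (missing h S x y z : nat) = 6 * #|M|.
  rewrite -ordered_triples; last by move=> e; rewrite !inE => /andP[/andP[/eqP]].
  apply: eq_bigr => x _; apply: eq_bigr => y _; apply: eq_bigr => z _; congr (nat_of_bool _).
  rewrite !inE cards3 disjoint_set3 !negb_and !negbK /missing -[h x y z]/([set x; y; z] \in H').
  by case: (x == y); case: (x == z); case: (y == z); rewrite /= ?andbF // andbC.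
rewrite eB eM leq_pmul2l // in le.
have c1 := cardsID (meeting S) H'; have c2 := cardsID H' (meeting S).
have e1 : H' :\: meeting S = B.
  apply/setP=> e; rewrite !inE negb_and negbK; case: (boolP (e \in H')) => [eH|]; rewrite ?andbF //.
  by rewrite (H_card H'3 eH) /= andbT.
have e2 : meeting S :\: H' = M by apply/setP=> e; rewrite !inE andbC.
rewrite e1 cH' in c1; rewrite e2 card_meeting cS -/f setIC in c2.
by move: c1 c2 le; lia.
Qed.

Theorem theorem1 :
  forall t : nat, 1 < t ->
  exists n0 : nat, forall n : nat, n0 <= n ->
    ex3_exp (fan t) n = 'C(n, 3) - 'C(n - t, 3).
Proof.
move=> t t1; have [n0 ub] := fan_upper_bound t1.
exists (n0 + t) => n nbig; apply/eqP; rewrite eqn_leq; apply/andP; split.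
  by apply/bigmax_leqP=> H /andP[]; apply: ub; lia.
pose S := [set x in take t (enum 'I_n)].
have cS : #|S| = t.
  rewrite cardsE; have /card_uniqP -> : uniq (take t (enum 'I_n)) by rewrite take_uniq // enum_uniq.
  by rewrite size_takel // -cardE card_ord; lia.
have <- : #|meeting S| = 'C(n, 3) - 'C(n - t, 3) by rewrite card_meeting cS.
by apply: leq_bigmax_cond; rewrite uniform3_meeting meeting_fan_free.
Qed.
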